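(* Let $\mu,\mu'\in\Delta^+_l$. (i) There is a unique smallest long positive root $\nu$ such that $\nu\succcurlyeq\mu$ and $\nu\succcurlyeq\mu'$ (that is, $\nu\in\Delta^+_l$ satisfies $\nu\succcurlyeq\mu$, $\nu\succcurlyeq\mu'$, and every $\gamma\in\Delta^+_l$ with $\gamma\succcurlyeq\mu$ and $\gamma\succcurlyeq\mu'$ satisfies $\gamma\succcurlyeq\nu$). For all $I\in\mathfrak{Ab}_\mu$ and $I'\in\mathfrak{Ab}_{\mu'}$, the intersection $I\cap I'$ belongs to $\mathfrak{Ab}_\nu$; in particular, $\nu$ does not depend on the choice of $I$ and $I'$. (ii) Furthermore, $I(\mu)_{\min}\cap I(\mu')_{\min}=I(\nu)_{\min}$, $I(\mu)_{\max}\cap I(\mu')_{\max}=I(\nu)_{\max}$, and every ideal in $\mathfrak{Ab}_\nu$ is of the form $I\cap I'$ with $I\in\mathfrak{Ab}_\mu$ and $I'\in\mathfrak{Ab}_{\mu'}$.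
   Context: Let $\mathfrak g$ be a complex simple Lie algebra with triangular decomposition $\mathfrak g=\mathfrak u\oplus\mathfrak t\oplus\mathfrak u^-$, Borel subalgebra $\mathfrak b=\mathfrak u\oplus\mathfrak t$, root system $\Delta$ of $(\mathfrak g,\mathfrak t)$, positive roots $\Delta^+$ (corresponding to $\mathfrak u$), simple roots $\Pi=\{\alpha_1,\dots,\alpha_n\}$, highest root $\theta$, Weyl group $W$, and $W$-invariant inner product $(\ ,\ )$ on $V=\bigoplus_i\mathbb R\alpha_i$. $\Delta^+_l$ is the set of long positive roots (all roots are long in the simply-laced case). Root order on $\Delta^+$: $\mu\preccurlyeq\nu$ iff $\nu-\mu$ is a non-negative integral combination of simple roots. Abelian ideals: $\mathfrak{Ab}$ is the poset (under inclusion) of subspaces $\mathfrak a\subset\mathfrak u$ with $[\mathfrak b,\mathfrak a]\subset\mathfrak a$ and $[\mathfrak a,\mathfrak a]=0$. Each is a sum of root spaces and is identified with the corresponding set $I\subset\Delta^+$, which is an upper ideal of $(\Delta^+,\preccurlyeq)$ with no two elements summing to a root. Minuscule elements: let $\widehat V=V\oplus\mathbb R\delta\oplus\mathbb R\lambda$ with $(\delta,V)=(\lambda,V)=(\delta,\delta)=(\lambda,\lambda)=0$, $(\delta,\lambda)=1$; $\alpha_0=\delta-\theta$; $\mu^\vee=2\mu/(\mu,\mu)$; $s_i(x)=x-(x,\alpha_i)\alpha_i^\vee$ for $0\le i\le n$; $\widehat W=\langle s_0,\dots,s_n\rangle\subset GL(\widehat V)$; $\widehat\Delta^+=\Delta^+\cup\{\gamma+k\delta\mid\gamma\in\Delta,\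 k\ge1\}$; $\mathcal N(w)=\{\nu\in\widehat\Delta^+\mid w(\nu)\in-\widehat\Delta^+\}$. An element $w\in\widehat W$ is minuscule if $\mathcal N(w)=\{\delta-\gamma\mid\gamma\in I_w\}$ for some $I_w\subset\Delta$. Then $I_w$ is an abelian ideal and $w\mapsto I_w$ is a bijection from minuscule elements onto $\mathfrak{Ab}$; write $w_I$ for the element corresponding to $I$. Rootlets: for a nonzero abelian ideal $I$, the rootlet is $\mathrm{rt}(I)=w_I(2\delta-\theta)$, which lies in $\Delta^+_l$. For $\mu\in\Delta^+_l$, $\mathfrak{Ab}_\mu$ is the set of nonzero abelian ideals with rootlet $\mu$. It is known that $\mathfrak{Ab}_\mu$ is nonempty and has a unique minimal element $I(\mu)_{\min}$ and a unique maximal element $I(\mu)_{\max}$. *)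

(* Defs.v *)
From HB Require Import structures.
From mathcomp Require Import all_boot all_order all_algebra.
From mathcomp Require Import boolp classical_sets reals complex.

Set Implicit Arguments.
Unset Strict Implicit.
Unset Printing Implicit Defensive.
Import Order.TTheory GRing.Theory Num.Theory.

Local Open Scope classical_set_scope.
Local Open Scope ring_scope.
Local Open Scope complex_scope.

Record lieAlgType (F : fieldType) := LieAlgType {
  lie_sort :> vectType F;
  bracket : lie_sort -> lie_sort -> lie_sort;
  bracket_linear_l : forall y, linear (bracket^~ y);
  bracket_linear_r : forall x, linear (bracket x);
  bracket_alternate : forall x, bracket x x = 0;
  bracket_jacobi : forall x y z,
    bracket x (bracket y z) + bracket y (bracket z x)
      + bracket z (bracket x y) = 0
}.

Notation "[ 'lie' x , y ]" := (bracket x y)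
  (at level 0, x at level 99, y at level 99).

Definition lie_ideal (F : fieldType) (g : lieAlgType F) (a : {vspace g}) : Prop :=
  forall x y : g, y \in a -> [lie x, y] \in a.

Definition lie_simple (F : fieldType) (g : lieAlgType F) : Prop :=
  (exists x y : g, [lie x, y] != 0) /\
  (forall a : {vspace g}, lie_ideal a -> a = 0%VS \/ a = fullv).

Definition lie_abelian (F : fieldType) (g : lieAlgType F) (a : {vspace g}) : Prop :=
  forall x y : g, x \in a -> y \in a -> [lie x, y] = 0.

Definition ad_diagonalizable (F : fieldType) (g : lieAlgType F) (h : g) : Prop :=
  exists e : seq g, basis_of fullv e /\
    forall x, x \in e -> exists c : F, [lie h, x] = c *: x.

(* The definition for semisimple Lie algebras over C: a maximal abelian subalgebra
   whose elements are ad-diagonalizable. *)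
Definition cartan_subalgebra (F : fieldType) (g : lieAlgType F) (t : {vspace g}) : Prop :=
  [/\ lie_abelian t,
      forall t' : {vspace g}, lie_abelian t' -> (t <= t')%VS -> t' = t
    & forall h : g, h \in t -> ad_diagonalizable h].

Notation dual F t := 'Hom(subvs_of t, (F : fieldType)^o).

Definition weight_space (F : fieldType) (g : lieAlgType F) (t : {vspace g})
    (l : dual F t) : set g :=
  [set x | forall h : subvs_of t, [lie vsval h, x] = (l h : F) *: x].

Definition is_root (F : fieldType) (g : lieAlgType F) (t : {vspace g})
    (l : dual F t) : Prop :=
  l != 0 /\ exists2 x : g, weight_space l x & x != 0.

(* A base (set of simple roots) of the root system of (g, t).  Given t, choosing
   a base amounts to choosing the triangular decomposition g = u + t + u^-. *)
Definition root_base (F : fieldType) (g : lieAlgType F) (t : {vspace g}) (n : nat)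
    (alpha : n.-tuple (dual F t)) : Prop :=
  [/\ free alpha,
      forall i, is_root (tnth alpha i)
    & forall l, is_root l -> exists c : 'I_n -> nat,
        l = \sum_i (tnth alpha i) *+ c i \/
        l = - \sum_i (tnth alpha i) *+ c i].

(* Elements of the (sub)monoid generated by S under composition; it is a group
   in the uses below, where S consists of involutions. *)
Inductive generated (X : Type) (S : set (X -> X)) : set (X -> X) :=
| generated_id : generated S id
| generated_comp s w : S s -> generated S w -> generated S (s \o w).

(* V is the real span of the simple roots, written in coordinates:
   x : 'rV[R]_n stands for \sum_i x_i alpha_i. *)
Section RootSystem.
Variables (R : realType) (g : lieAlgType R[i]) (t : {vspace g}) (n : nat).
Variable alpha : n.-tuple (dual R[i] t).

Local Notation V := 'rV[R]_n.

Definition weight_of (x : V) : dual R[i] t :=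
  \sum_i (x ord0 i)%:C *: tnth alpha i.

Definition Delta : set V := [set x | is_root (weight_of x)].

Definition root_space (x : V) : set g := weight_space (weight_of x).

Definition simple_root (i : 'I_n) : V := delta_mx ord0 i.

Definition root_le (x y : V) : Prop :=
  exists c : 'I_n -> nat, y - x = \sum_i simple_root i *+ c i.

Definition Delta_pos : set V := [set x | Delta x /\ root_le 0 x].

Definition highest_root (theta : V) : Prop :=
  Delta_pos theta /\ forall x, Delta_pos x -> root_le x theta.

(* The coroot of x is the element h of [g_x, g_{-x}] on which x takes the value
   2, and the reflection of y in x is y - y(h) x.  The real part only changes
   the type: y(h) is real for y in V. *)
Definition is_coroot (x : V) (h : subvs_of t) : Prop :=
  (weight_of x h : R[i]) = 2 /\
  exists e f : g, [/\ root_space x e, root_space (- x) f & [lie e, f] = vsval h].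

Definition weyl_reflection : set (V -> V) :=
  [set s | exists x h, [/\ Delta x, is_coroot x h
     & s = fun y => y - complex.Re (weight_of y h : R[i]) *: x]].

Definition weyl_group : set (V -> V) := generated weyl_reflection.

(* The bilinear form on V with Gram matrix G. *)
Definition form (G : 'M[R]_n) (x y : V) : R := (x *m G *m y^T) ord0 ord0.

Definition invariant_inner_product (G : 'M[R]_n) : Prop :=
  [/\ G^T = G,
      forall x, x != 0 -> 0 < form G x x
    & forall w, weyl_group w -> forall x y, form G (w x) (w y) = form G x y].

Definition Delta_long_pos (G : 'M[R]_n) : set V :=
  [set x | Delta_pos x /\ forall y, Delta y -> form G y y <= form G x x].

Definition nilradical : set g :=
  [set x | exists s : seq g,
     (forall y, y \in s -> exists2 r, Delta_pos r & root_space r y) /\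
     x = \sum_(y <- s) y].

Definition borel : set g :=
  [set x | exists y h, [/\ nilradical y, h \in t & x = y + h]].

Definition abelian_ideal (a : {vspace g}) : Prop :=
  [/\ forall x, x \in a -> nilradical x,
      forall x y, borel x -> y \in a -> [lie x, y] \in a
    & forall x y, x \in a -> y \in a -> [lie x, y] = 0].

Definition ideal_roots (a : {vspace g}) : set V :=
  [set r | Delta_pos r /\ forall x, root_space r x -> x \in a].

(* (x, a, b) stands for x + a delta + b lambda. *)
Definition affV : lmodType R := (V * R^o * R^o)%type.

Definition affV_of (x : V) : affV := (x, 0, 0).
Definition delta : affV := (0, 1, 0).

Section Affine.
Variables (G : 'M[R]_n) (theta : V).

Definition aff_form (x y : affV) : R :=
  form G x.1.1 y.1.1 + x.1.2 * y.2 + x.2 * y.1.2.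

Definition aff_coroot (x : affV) : affV := (2 / aff_form x x) *: x.

Definition aff_reflection (a x : affV) : affV :=
  x - aff_form x a *: aff_coroot a.

Definition aff_simple_root : set affV :=
  [set a | a = delta - affV_of theta \/ exists i, a = affV_of (simple_root i)].

Definition aff_weyl_group : set (affV -> affV) :=
  generated [set s | exists2 a, aff_simple_root a & s = aff_reflection a].

Definition aff_Delta_pos : set affV :=
  [set x | (exists2 r, Delta_pos r & x = affV_of r) \/
           (exists r k, [/\ Delta r, (1 <= k)%N & x = affV_of r + delta *+ k])].

Definition inversions (w : affV -> affV) : set affV :=
  [set x | aff_Delta_pos x /\ aff_Delta_pos (- w x)].

(* w is the minuscule element w_I attached to the set I of roots. *)
Definition minuscule_for (I : set V) (w : affV -> affV) : Prop :=
  aff_weyl_group w /\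
  inversions w = [set x | exists2 r, I r & x = delta - affV_of r].

Definition rootlet (a : {vspace g}) (mu : V) : Prop :=
  exists2 w, minuscule_for (ideal_roots a) w
           & w (delta *+ 2 - affV_of theta) = affV_of mu.

Definition Ab (mu : V) : set {vspace g} :=
  [set a | [/\ abelian_ideal a, a != 0%VS & rootlet a mu]].

Definition Ab_minimal (mu : V) (a : {vspace g}) : Prop :=
  Ab mu a /\ forall b, Ab mu b -> (b <= a)%VS -> b = a.

Definition Ab_maximal (mu : V) (a : {vspace g}) : Prop :=
  Ab mu a /\ forall b, Ab mu b -> (a <= b)%VS -> b = a.

Definition is_Imin (mu : V) (a : {vspace g}) : Prop := unique (Ab_minimal mu) a.

Definition is_Imax (mu : V) (a : {vspace g}) : Prop := unique (Ab_maximal mu) a.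

End Affine.

Definition is_long_join (G : 'M[R]_n) (mu mu' nu : V) : Prop :=
  [/\ Delta_long_pos G nu, root_le mu nu, root_le mu' nu
    & forall x, Delta_long_pos G x -> root_le mu x -> root_le mu' x ->
        root_le nu x].

End RootSystem.

(* Main.v *)
(* Work with the affine roots [r + k delta] and words in the affine simple reflections.
   If [w] is minuscule for [I] and [s_i w] is minuscule for [I] plus one root [gam],
   the rootlet changes by a nonnegative multiple of [alpha_i], and it is unchanged
   exactly when [gam] is orthogonal to [theta].  Hence rootlets decrease when ideals
   grow, and the rootlet is determined by the part [I_theta] of [I] not orthogonal to
   [theta]; that part corresponds to [v s_0] with [v] finite, and the condition
   [v theta = rootlet] determines [v].  So for a long root [kap] there is one ideal
   [K_kap] of this kind, and it is contained in every ideal with rootlet below [kap].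
   If [I] and [I'] have rootlets [mu] and [mu'], the rootlet of their intersection is
   thus above [mu] and [mu'], and below every long [kap] above both, because [K_kap]
   is contained in the intersection.  Conversely, an ideal [J] whose rootlet [nu] is
   this join extends, by adding roots not orthogonal to [theta], to ideals with
   rootlets [mu] and [mu']; their intersection has rootlet [nu], hence the same
   [theta]-part as [J], hence equals [J].  The extremal ideals follow. *)

Require Import Defs.
From HB Require Import structures.
From mathcomp Require Import all_boot all_order all_algebra.
From mathcomp Require Import boolp classical_sets reals complex.
From mathcomp Require Import ring lra zify.

Set Implicit Arguments.
Unset Strict Implicit.
Unset Printing Implicit Defensive.
Import Order.TTheory GRing.Theory Num.Theory.

Local Open Scope ring_scope.

(* [sesquilinear.form] shadows the bilinear form of [Defs]. *)
Local Notation form := Defs.form.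

(** * Weight space decomposition *)

(** The statement starts from a Lie algebra, so the facts on roots are derived from sl2 triples and
    collected in [based_root_system]; what follows is combinatorics of words, until sets of roots
    are turned back into subspaces. The join is never constructed inside the root poset: it is the
    rootlet of one intersection, and the bounds proved for that rootlet determine it by
    antisymmetry, so it cannot depend on the chosen ideals. The obstacle is short simple roots:
    reflecting a long root in a short [alpha_i] can move it by two or three times [alpha_i], so a
    chain of reflections between comparable long roots might overshoot. Integrality of coordinates
    with respect to the simple coroots ([long_coord]) prevents this, and is why a rootlet can be
    moved exactly to a prescribed long root. The two directions are not symmetric. Lowering a
    rootlet adds a root to the ideal and works for every minuscule word. Raising it removes a root,
    and this is done for words [v s_0] with [v] finite, where the level of the root in question can
    be computed. *)

Section LieBracket.
Variables (F : fieldType) (g : lieAlgType F).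
Implicit Types x y z : g.

HB.instance Definition _ x :=
  GRing.isLinear.Build F g g *:%R (bracket x) (bracket_linear_r x).

Lemma lieDr x y z : [lie x, y + z] = [lie x, y] + [lie x, z].
Proof. exact: linearD. Qed.

Lemma lieZr a x y : [lie x, a *: y] = a *: [lie x, y].
Proof. exact: linearZ. Qed.

Lemma lie0r x : [lie x, 0] = 0.
Proof. exact: linear0. Qed.

Lemma lieDl x y z : [lie x + y, z] = [lie x, z] + [lie y, z].
Proof. by have := bracket_linear_l z 1 x y; rewrite !scale1r. Qed.

Lemma lieC x y : [lie x, y] = - [lie y, x].
Proof.
apply/eqP; rewrite -addr_eq0; apply/eqP; have := bracket_alternate (x + y).
by rewrite lieDr !lieDl !bracket_alternate add0r addr0 addrC.
Qed.

Lemma lieZl a x y : [lie a *: x, y] = a *: [lie x, y].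
Proof. by rewrite lieC lieZr -scalerN -lieC. Qed.

Lemma lie0l x : [lie 0, x] = 0.
Proof. by rewrite lieC lie0r oppr0. Qed.

Lemma lie_suml I (r : seq I) (f : I -> g) y :
  [lie \sum_(i <- r) f i, y] = \sum_(i <- r) [lie f i, y].
Proof.
by elim: r => [|i r IH]; rewrite ?big_nil ?lie0l // !big_cons lieDl IH.
Qed.

Lemma lie_jacobi x y z : [lie x, [lie y, z]] = [lie [lie x, y], z] + [lie y, [lie x,
  z]].
Proof.
have := bracket_jacobi x y z.
rewrite (lieC z [lie x, y]) (lieC z x) linearN /= => /eqP.
by rewrite subr_eq0 addrC => /eqP <-; rewrite addrC subrK.
Qed.

End LieBracket.

Import VectorInternalTheory.

Lemma free_b2mx_unit (F : fieldType) (V : vectType F) (e : (dim V).-tuple V) :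
  free e = (b2mx e \in unitmx).
Proof.
have spanE : span e = mx2vs (b2mx e) by rewrite unlock tvalK; case: _ / (esym _).
by rewrite -row_free_unit /free /dimv spanE genmxE size_tuple.
Qed.

(** In the internal coordinates [v2r] this is simultaneous diagonalization of commuting
    diagonalizable matrices, [codiagonalizableP]; the rows of the diagonalizing matrix are the
    eigenvectors. *)
Lemma simultaneous_eigenbasis (F : fieldType) (V : vectType F) (fs : seq 'End(V)) :
  {in fs &, forall f1 f2, (f1 \o f2 = f2 \o f1)%VF} ->
  (forall f, f \in fs -> exists e : seq V, basis_of fullv e /\
    forall x, x \in e -> exists c : F, f x = c *: x) ->
  exists e : (dim V).-tuple V, basis_of fullv e /\
    forall f i, f \in fs -> exists c : F, f (tnth e i) = c *: tnth e i.
Proof.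
move=> fC fd.
have appE (f : 'End(V)) u : v2r (f u) = v2r u *m f2mx f by rewrite unlock /= r2vK.
have [/(_ _)] := @codiagonalizableP F (dim V) (map f2mx fs).
case.
  split.
    move=> _ _ /mapP[f1 f1s ->] /mapP[f2 f2s ->].
    apply/row_matrixP => i; rewrite !rowE !mulmxA.
    set u := delta_mx _ _; have -> : u = v2r (r2v u) by rewrite r2vK.
    by rewrite -!appE -!comp_lfunE fC.
  move=> _ /mapP[f ffs ->]; have [e [eb ed]] := fd f ffs.
  have se : size e = dim V.
    by rewrite -dimvf -(span_basis eb); apply/esym/eqP/(basis_free eb).
  pose e' := Tuple (introT eqP se).
  have P1 : b2mx e' \in unitmx by rewrite -free_b2mx_unit; apply: basis_free eb.
  exists (b2mx e') => //; apply/diagonalizable_forPex.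
  have ev i : exists c, f (tnth e' i) = c *: tnth e' i by apply/ed/mem_tnth.
  have [c cE] := choice ev.
  exists (\row_i c i); apply/(simmxP P1); apply/row_matrixP => i.
  by rewrite !row_mul row_diag_mx -scalemxAl -rowE rowK mxE -appE cE linearZ.
move=> P Pu /allP Pd.
pose e := [tuple r2v (row i P) | i < dim V].
have eP : b2mx e = P by apply/row_matrixP => i; rewrite rowK tnth_mktuple r2vK.
exists e; split.
  by rewrite basisEfree free_b2mx_unit eP Pu subvf size_tuple dimvf /=.
move=> f i ffs; have /diagonalizable_forPex[D /(simmxP Pu) E] := Pd _ (map_f _ ffs).
exists (D 0 i); apply: v2r_inj; rewrite linearZ /= appE tnth_mktuple r2vK -row_mul E.
by rewrite row_mul row_diag_mx -scalemxAl -rowE.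
Qed.

Section Weights.
Variables (F : numFieldType) (g : lieAlgType F) (t : {vspace g}).
Implicit Types (l m : dual F t) (x y z u : g) (h : subvs_of t).

(** It suffices to diagonalize the finitely many operators given by a basis of [t]; the other
    elements of [t] then act diagonally by linearity. *)
Lemma weight_basis : cartan_subalgebra t ->
  exists (e : (dim g).-tuple g) (lam : 'I_(dim g) -> dual F t),
    basis_of fullv e /\ forall i, weight_space (lam i) (tnth e i).
Proof.
move=> [t_ab _ t_diag].
have adC x y : x \in t -> y \in t ->
    (linfun (bracket x) \o linfun (bracket y) = linfun (bracket y) \o linfun (bracket x))%VF.
  move=> xt yt; apply/lfunP => z; rewrite !comp_lfunE !lfunE /=.
  by rewrite lie_jacobi (t_ab x y) // lie0l add0r.
have [] := @simultaneous_eigenbasis F g [seq linfun (bracket x) | x <- vbasis t].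
- by move=> _ _ /mapP[x xt ->] /mapP[y yt ->]; apply: adC; apply: vbasis_mem.
- move=> _ /mapP[x xt ->]; have [e [eb ed]] := t_diag x (vbasis_mem xt).
  by exists e; split=> // y ye; have [c cE] := ed y ye; exists c; rewrite lfunE.
move=> e [eb ed].
have evec h i : exists c, [lie vsval h, tnth e i] = c *: tnth e i.
  have ht : vsval h \in t by apply: subvsP.
  rewrite (coord_vbasis ht) lie_suml.
  have /fin_all_exists[c cE] (j : 'I_(\dim t)) :
      exists c, [lie (vbasis t)`_j, tnth e i] = c *: tnth e i.
    have jt : (vbasis t)`_j \in vbasis t by rewrite mem_nth // size_tuple.
    have [c] := ed _ i (map_f (fun x => linfun (bracket x)) jt).
    by rewrite lfunE /=; exists c.
  exists (\sum_j coord (vbasis t) j (vsval h) * c j).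
  by rewrite scaler_suml; apply: eq_bigr => j _; rewrite lieZl cE scalerA.
(* The eigenvalue is written as a coordinate of [[h, e_i]], which makes it visibly linear in [h]. *)
pose f i h : F^o := coord e i [lie vsval h, tnth e i].
have f_lin i : linear (f i).
  by move=> a h1 h2; rewrite /f linearP /= lieDl lieZl linearP.
pose lam i : dual F t :=
  linfun (HB.pack_for {linear subvs_of t -> F^o} (f i)
    (GRing.isLinear.Build _ _ _ _ (f i) (f_lin i))).
exists e, lam; split=> // i h; have [c cE] := evec h i.
rewrite cE lfunE /= /f cE linearZ /= (tnth_nth 0) coord_free ?(basis_free eb) //.
by rewrite eqxx mulr1.
Qed.

Lemma weight_bracket l m x y :
  weight_space l x -> weight_space m y -> weight_space (l + m) [lie x, y].
Proof.
move=> xl ym h; rewrite lie_jacobi xl ym lieZl lieZr -scalerDl.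
by rewrite add_lfunE.
Qed.

Lemma weight_add l x y : weight_space l x -> weight_space l y -> weight_space l (x + y).
Proof. by move=> xl yl h; rewrite lieDr xl yl scalerDr. Qed.

Lemma weight_scale l c x : weight_space l x -> weight_space l (c *: x).
Proof. by move=> xl h; rewrite lieZr xl !scalerA mulrC. Qed.

(** A vector commuting with [t] spans together with [t] an abelian subalgebra, so maximality of [t]
    applies. *)
Lemma cartan_weight0 : cartan_subalgebra t ->
  forall x, weight_space (0 : dual F t) x -> x \in t.
Proof.
move=> [t_ab t_max _] x x0.
have xC y : y \in t -> [lie y, x] = 0.
  by move=> yt; have := x0 (vsproj t y); rewrite vsprojK // zero_lfunE scale0r.
rewrite -(t_max (t + <[x]>)%VS) ?addvSl //.
  by rewrite memvE addvSr.
move=> _ _ /memv_addP[y1 yt1 [_ /vlineP[c1 ->] ->]] /memv_addP[y2 yt2 [_ /vlineP[c2 ->] ->]].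
rewrite lieDl !lieDr !lieZl !lieZr t_ab // xC // bracket_alternate.
by rewrite (lieC x) xC // oppr0 !scaler0 !addr0.
Qed.

End Weights.

(** * The Killing form and root strings *)

(** The matrix of values of a free family on a basis of the space has rank [n], so the linear system
    for [v] is solvable. *)
Lemma free_functionals_eval (F : fieldType) (V : vectType F) n
    (alpha : n.-tuple 'Hom(V, F^o)) (a : 'rV[F]_n) : free alpha ->
  exists v : V, forall i, tnth alpha i v = a 0 i.
Proof.
move=> /freeP alpha_free; pose b := vbasis {:V}.
pose A := \matrix_(k < \dim {:V}, i < n) (tnth alpha i b`_k : F).
have /row_fullP[B BA] : row_full A.
  rewrite /row_full -mxrank_tr; apply/row_freeP/row_freeP/inj_row_free => u uA0.
  apply/rowP => i; rewrite mxE.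
  apply: (alpha_free (fun i => u 0 i)) => {i}; apply/lfunP => v.
  rewrite zero_lfunE (coord_vbasis (memvf v)) linear_sum big1 // => k _.
  rewrite linearZ /= sum_lfunE; have /rowP/(_ k) := uA0; rewrite !mxE => uk0.
  rewrite (_ : \sum_i _ = 0) ?scaler0 // -[RHS]uk0; apply: eq_bigr => i _.
  by rewrite scale_lfunE !mxE -tnth_nth.
exists (\sum_k (a *m B) 0 k *: b`_k) => i; rewrite linear_sum /=.
rewrite -[a in RHS]mulmx1 -BA mulmxA mxE; apply: eq_bigr => k _.
by rewrite linearZ mxE [A k i]mxE.
Qed.

Section Killing.
Variables (F : numFieldType) (g : lieAlgType F) (t : {vspace g}).
Variables (e : (dim g).-tuple g) (lam : 'I_(dim g) -> dual F t).
Hypothesis e_basis : basis_of fullv e.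
Hypothesis e_weight : forall i, weight_space (lam i) (tnth e i).
Implicit Types (l m : dual F t) (x y z u : g) (h : subvs_of t).

Lemma coordE x : x = \sum_i coord e i x *: tnth e i.
Proof.
rewrite [LHS](coord_basis e_basis (memvf x)); apply: eq_bigr => i _.
by rewrite -tnth_nth.
Qed.

Lemma coord_tnth i j : coord e j (tnth e i) = (i == j)%:R.
Proof. by rewrite (tnth_nth 0) coord_free // (basis_free e_basis). Qed.

Lemma eq_coord x y : (forall i, coord e i x = coord e i y) -> x = y.
Proof. by move=> xy; rewrite [x]coordE [y]coordE; apply: eq_bigr => i _;
  rewrite xy. Qed.

Lemma coord_neq0 x : x != 0 -> exists i, coord e i x != 0.
Proof.
move=> x0; apply: contrapT => /forallNP nx; case/eqP: x0; apply: eq_coord => i.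
by rewrite linear0; apply/eqP/negPn/negP.
Qed.

Lemma tnth_neq0 i : tnth e i != 0.
Proof.
by apply/eqP => ei0; have := coord_tnth i i; rewrite ei0 linear0 eqxx => /eqP;
  rewrite eq_sym oner_eq0.
Qed.

Lemma coord_cartan h i x : coord e i [lie vsval h, x] = lam i h * coord e i x.
Proof.
rewrite {1}[x]coordE linear_sum /= linear_sum /= (bigD1 i) //= big1 => [|j ji].
  by rewrite lieZr e_weight !linearZ /= coord_tnth eqxx addr0 mulr1 mulrC.
by rewrite lieZr e_weight !linearZ /= coord_tnth (negPf ji) !mulr0.
Qed.

Lemma coord_weight l x :
  weight_space l x <-> forall i, coord e i x != 0 -> lam i = l.
Proof.
split=> [xl i xi|xl h].
  apply/lfunP => h; have /(congr1 (coord e i)) := xl h.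
  by rewrite coord_cartan linearZ /= => /(mulIf xi).
apply: eq_coord => i; rewrite coord_cartan linearZ /=.
by have [->|/xl ->//] := eqVneq (coord e i x) 0; rewrite !mulr0.
Qed.

Lemma weight_lam l x : x != 0 -> weight_space l x -> exists i, lam i = l.
Proof. by move=> /coord_neq0[i xi] /coord_weight xl; exists i; apply: xl. Qed.

Lemma is_root_lam l : is_root l <-> l != 0 /\ exists i, lam i = l.
Proof.
split=> [[l0 [x xl x0]]|[l0 [i il]]]; split=> //; first exact: weight_lam xl.
by exists (tnth e i); [rewrite -il | exact: tnth_neq0].
Qed.

(** Rows are the images of basis vectors, so [ad_mx x *m ad_mx y] represents ad y after ad x. This
    reverses the commutator in [ad_mx_lie]. *)
Definition ad_mx x := \matrix_(i, j) coord e j [lie x, tnth e i].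

Lemma ad_mxM x y : ad_mx x *m ad_mx y =
  \matrix_(i, j) coord e j [lie y, [lie x, tnth e i]].
Proof.
apply/matrixP => i j; rewrite !mxE [in RHS](coordE [lie x, _]) !linear_sum /=.
by apply: eq_bigr => k _; rewrite !mxE !linearZ.
Qed.

Lemma ad_mx_lie x y : ad_mx [lie x, y] = ad_mx y *m ad_mx x - ad_mx x *m ad_mx y.
Proof.
apply/matrixP => i j; rewrite !ad_mxM !mxE lie_jacobi linearD /=.
by rewrite addrK.
Qed.

Lemma ad_mx_linear : linear ad_mx.
Proof. by move=> a x y; apply/matrixP => i j; rewrite !mxE lieDl lieZl linearP. Qed.

HB.instance Definition _ :=
  GRing.isLinear.Build F g 'M[F]_(dim g) *:%R ad_mx ad_mx_linear.

Definition killing x y : F := \tr (ad_mx x *m ad_mx y).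

Lemma killingC x y : killing x y = killing y x.
Proof. exact: mxtrace_mulC. Qed.

Lemma killing_linear y : linear (killing^~ y : g -> F^o).
Proof. by move=> a x z; rewrite /killing linearP mulmxDl -scalemxAl linearP. Qed.

Lemma killingDl x z y : killing (x + z) y = killing x y + killing z y.
Proof. by rewrite -[x]scale1r killing_linear !scale1r. Qed.

Lemma killingZl a x y : killing (a *: x) y = a * killing x y.
Proof. by rewrite /killing linearZ -scalemxAl linearZ. Qed.

Lemma killingZr a x y : killing x (a *: y) = a * killing x y.
Proof. by rewrite killingC killingZl killingC. Qed.

Lemma killing_sumr x I (r : seq I) (f : I -> g) :
  killing x (\sum_(i <- r) f i) = \sum_(i <- r) killing x (f i).
Proof.
elim: r => [|i r IH]; last by rewrite !big_cons killingC killingDl !(killingC _ x) IH.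
by rewrite !big_nil killingC -(scale0r 0) killingZl mul0r.
Qed.

Lemma killing_lie x y z : killing [lie x, y] z = killing x [lie y, z].
Proof.
rewrite /killing !ad_mx_lie mulmxBl mulmxBr !linearB /=; congr (_ - _).
  by rewrite -mulmxA mxtrace_mulC mulmxA.
by rewrite mulmxA.
Qed.

Lemma killing_weight l m x y : weight_space l x -> weight_space m y ->
  l + m != 0 -> killing x y = 0.
Proof.
move=> xl ym /lfunPn[h]; rewrite add_lfunE zero_lfunE => lm0.
have := killing_lie x (vsval h) y.
rewrite lieC xl ym -scaleNr killingZl [RHS]killingC killingZl killingC => /eqP.
rewrite -subr_eq0 mulNr -opprD -mulrDl oppr_eq0 mulf_eq0 (negPf lm0).
by move/eqP.
Qed.

Lemma killing_cartan h1 h2 :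
  killing (vsval h1) (vsval h2) = \sum_i lam i h1 * lam i h2.
Proof.
rewrite /killing ad_mxM /mxtrace; apply: eq_bigr => i _.
by rewrite mxE !coord_cartan coord_tnth eqxx mulr1 mulrC.
Qed.

(** The radical of the Killing form is an ideal, and it is not all of [g] because [h] is not
    isotropic; simplicity leaves only zero. *)
Lemma killing_nondeg h : lie_simple g -> killing (vsval h) (vsval h) != 0 ->
  forall x, x != 0 -> exists i, killing x (tnth e i) != 0.
Proof.
move=> [_ simple] kh x x0; apply: contrapT => /forallNP xe.
pose f x := \row_i killing x (tnth e i).
have f_lin : linear f by move=> a y z; apply/rowP => i; rewrite !mxE killing_linear.
pose fl : 'Hom(g, 'rV[F]_(dim g)) := linfun (HB.pack_for {linear g -> 'rV[F]_(dim g)} f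
    (GRing.isLinear.Build _ _ _ _ f f_lin)).
have kerP y : reflect (forall z, killing y z = 0) (y \in lker fl).
  rewrite memv_ker lfunE /=; apply: (iffP eqP) => [/rowP y0 z|y0].
    rewrite (coordE z) killing_sumr big1 // => i _.
    by have := y0 i; rewrite !mxE killingZr => ->; rewrite mulr0.
  by apply/rowP => i; rewrite !mxE.
have [] := simple (lker fl).
- move=> y z /kerP y0; apply/kerP => u.
  by rewrite lieC -scaleN1r killingZl killing_lie y0 mulr0.
- move/vspaceP/(_ x); rewrite memv0 (negPf x0) => /kerP[] z.
  rewrite (coordE z) killing_sumr big1 // => i _.
  rewrite killingZr; have /negP/negPn/eqP -> := xe i.
  by rewrite mulr0.
- by move/vspaceP/(_ (vsval h)); rewrite memvf => /kerP/(_ (vsval h))/eqP;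
  rewrite (negPf kh).
Qed.

End Killing.

Lemma lfun_mulrnE (F : fieldType) (V W : vectType F) (l : 'Hom(V, W)) k v :
  (l *+ k) v = l v *+ k.
Proof. by elim: k => [|k IH]; rewrite ?mulr0n ?zero_lfunE // !mulrS add_lfunE IH. Qed.

Lemma lfun_mulrzE (F : fieldType) (V W : vectType F) (l : 'Hom(V, W)) (c : int) v :
  (l *~ c) v = l v *~ c.
Proof. by case: c => k; rewrite ?NegzE ?mulrNz ?opp_lfunE -?pmulrn lfun_mulrnE. Qed.

(** * Root strings and sl2 triples *)

Section RootStrings.
Variables (F : numFieldType) (g : lieAlgType F) (t : {vspace g}).
Variables (e : (dim g).-tuple g) (lam : 'I_(dim g) -> dual F t).
Hypothesis e_basis : basis_of fullv e.
Hypothesis e_weight : forall i, weight_space (lam i) (tnth e i).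
Implicit Types (l m : dual F t) (x y z u : g) (h : subvs_of t).

Lemma iter_weight l m x u k : weight_space l x -> weight_space m u ->
  weight_space (m + l *+ k) (iter k (bracket x) u).
Proof.
move=> xl um; elim: k => [|k IH]; first by rewrite mulr0n addr0.
by rewrite iterS mulrS addrCA; apply: weight_bracket.
Qed.

Lemma iter_nilpotent l m x u : l != 0 -> weight_space l x -> weight_space m u ->
  exists k, iter k (bracket x) u = 0.
Proof.
move=> /lfunPn[h]; rewrite zero_lfunE => lh xl um; apply: contrapT => /forallNP nk.
have /choice[f fE] k : exists i, lam i = m + l *+ k.
  have /eqP k0 := nk k.
  exact: (weight_lam e_basis e_weight k0 (iter_weight k xl um)).
have f_inj : injective f.
  move=> j k jk; have := fE j; rewrite jk fE => /addrI/lfunP/(_ h)/eqP.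
  rewrite !lfun_mulrnE -mulr_natr -[eqbRHS]mulr_natr => /eqP/(mulfI lh)/eqP.
  by rewrite eqr_nat => /eqP.
have fo_inj : injective (fun k : 'I_(dim g).+1 => f k).
  by move=> j k /f_inj/val_inj.
by have := leq_card _ fo_inj; rewrite !card_ord ltnn.
Qed.

Section String.
Variables (l m : dual F t) (x y u : g) (h : subvs_of t).
Hypotheses (xl : weight_space l x) (um : weight_space m u) (xyh : [lie x, y] = vsval h).
Hypothesis (xyu : [lie x, [lie y, u]] = 0).

(** The usual sl2 computation, for an arbitrary value [l h]; both sides are doubled to avoid the
    half in front of [k * l h]. *)
Lemma string_formula k : 2 *: [lie y, iter k.+1 (bracket x) u] =
  - (k.+1%:R * (2 * m h + k%:R * l h)) *: iter k (bracket x) u.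
Proof.
have yx z : [lie y, [lie x, z]] = [lie x, [lie y, z]] - [lie vsval h, z].
  by rewrite -xyh [X in _ = X - _]lie_jacobi addrC addKr.
elim: k => [|k IH].
  rewrite /= yx xyu sub0r um -scaleNr scalerA; congr (_ *: _); ring.
rewrite iterS yx -/(iter k.+1 (bracket x) u) scalerBr -lieZr IH lieZr -iterS.
rewrite (iter_weight k.+1 xl um) add_lfunE lfun_mulrnE scalerA -scalerBl.
congr (_ *: _); rewrite -mulr_natr.
rewrite !(mulrS, mulr_natr); ring.
Qed.

Lemma string_neq0 k : u != 0 ->
  (forall j, (j < k)%N -> 2 * (m h : F) + j%:R * (l h : F) != 0) ->
  iter k (bracket x) u != 0.
Proof.
move=> u0; elim: k => //= k IH kP; apply/eqP => k0.
have := string_formula k; rewrite /= k0 lie0r scaler0 => /esym/eqP.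
rewrite scaler_eq0 oppr_eq0 mulf_eq0 pnatr_eq0 (negPf (kP k _)) //=.
by apply/negP/IH => j jk; apply: kP; apply: ltnW.
Qed.

(* [ad x] is nilpotent, so one of the factors in [string_formula] vanishes. *)
Lemma string_weight : l != 0 -> u != 0 ->
  exists k : nat, 2 * (m h : F) + k%:R * (l h : F) = 0.
Proof.
move=> l0 u0; apply: contrapT => /forallNP nk.
have [k k0] := iter_nilpotent l0 xl um.
have /negP[] : iter k (bracket x) u != 0 by apply: string_neq0 => // j _; apply/eqP/nk.
by apply/eqP.
Qed.

End String.

Hypothesis t_cartan : cartan_subalgebra t.
Hypothesis killing_nondeg : forall x, x != 0 -> exists i, killing e x (tnth e i) != 0.

Lemma killing_pair l x : x != 0 -> weight_space l x ->
  exists2 y, weight_space (- l) y & killing e x y != 0.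
Proof.
move=> x0 xl; have [i xi] := killing_nondeg x0; exists (tnth e i) => //.
suff /eqP <- : lam i == - l by [].
rewrite -addr_eq0 addrC; apply: contraNT xi => li.
by rewrite (killing_weight e_basis xl (e_weight i) li).
Qed.

Lemma root_opp l : is_root l -> is_root (- l).
Proof.
move=> [l0 [x xl x0]]; split; first by rewrite oppr_eq0.
have [y yl xy] := killing_pair x0 xl; exists y => //; apply: contraNneq xy => ->.
by rewrite killingC -(scale0r 0) killingZl mul0r.
Qed.

Lemma weight_bracket_opp l x y : weight_space l x -> weight_space (- l) y ->
  exists h, [lie x, y] = vsval h.
Proof.
move=> xl yl; exists (vsproj t [lie x, y]); rewrite vsprojK //.
by apply: (cartan_weight0 t_cartan); rewrite -(subrr l); apply: weight_bracket.
Qed.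

Lemma killing_coroot l x y h h' : weight_space l x -> [lie x, y] = vsval h ->
  killing e (vsval h) (vsval h') = l h' * killing e x y.
Proof.
by move=> xl <-; rewrite killingC -(killing_lie e_basis) xl killingZl.
Qed.

Lemma root_coroot_neq0 l x y h : l != 0 -> weight_space l x -> weight_space (- l) y ->
  [lie x, y] = vsval h -> killing e x y != 0 -> (l h : F) != 0.
Proof.
move=> l0 xl yl xyh kxy; apply/negP => /eqP lh0.
(* If [l h = 0], the lowest vector of the string through [e_i] gives [lam i h = 0]
   for every [i], hence [h = 0]. *)
have lamh i : lam i h = 0.
  have Nl0 : - l != 0 by rewrite oppr_eq0.
  have ex0 : exists k, iter k (bracket y) (tnth e i) == 0.
    by have [k k0] := iter_nilpotent Nl0 yl (e_weight i); exists k; apply/eqP.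
  case: (ex_minnP ex0) => -[|k] k0 k_min.
    by move: k0; rewrite /= (negPf (tnth_neq0 e_basis i)).
  set u := iter k (bracket y) (tnth e i).
  have u0 : u != 0 by apply/negP => /k_min; rewrite ltnn.
  have yu : [lie y, u] = 0 by apply/eqP.
  have um := iter_weight k yl (e_weight i).
  have xyu : [lie x, [lie y, u]] = 0 by rewrite yu lie0r.
  have [j] := string_weight xl um xyh xyu l0 u0.
  rewrite add_lfunE lfun_mulrnE opp_lfunE lh0 oppr0 mul0rn addr0 mulr0 addr0 => /eqP.
  by rewrite mulf_eq0 pnatr_eq0 => /eqP.
have /lfunPn[h'] := l0; rewrite zero_lfunE => /negP[].
have /eqP := killing_coroot h' xl xyh.
rewrite (killing_cartan e_basis e_weight) big1 => [|i _]; last by rewrite lamh mul0r.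
by rewrite eq_sym mulf_eq0 (negPf kxy) orbF.
Qed.

Lemma cartan_nondeg h : (forall h', killing e (vsval h) (vsval h') = 0) -> h = 0.
Proof.
move=> kh0; apply/eqP/negP => /negP h0.
have [|i] := @killing_nondeg (vsval h).
  by apply: contraNneq h0 => h0; apply/eqP/subvs_inj; rewrite h0 linear0.
case/negP; have [li|li] := eqVneq (lam i) 0.
  have /vsprojK <- : tnth e i \in t.
    by apply: (cartan_weight0 t_cartan); rewrite -li.
  by rewrite kh0.
have hw : weight_space (0 : dual F t) (vsval h).
  move=> h1; rewrite zero_lfunE scale0r; case: t_cartan => + _ _.
  by apply; exact: subvsP.
by rewrite (killing_weight e_basis hw (e_weight i)) // add0r.
Qed.

Definition sl2_triple l x y h :=
  [/\ weight_space l x, weight_space (- l) y, [lie x, y] = vsval h & (l h : F) = 2].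

Lemma sl2_triple_exists l x : is_root l -> weight_space l x -> x != 0 ->
  exists y h, sl2_triple l x y h.
Proof.
move=> [l0 _] xl x0; have [y yl kxy] := killing_pair x0 xl.
have [h xyh] := weight_bracket_opp xl yl.
have lh0 := root_coroot_neq0 l0 xl yl xyh kxy.
exists ((2 / l h) *: y), ((2 / l h) *: h); split=> //; first exact: weight_scale.
  by rewrite lieZr xyh linearZ.
by rewrite linearZ /= -[LHS]/(_ * _) divfK.
Qed.

Lemma sl2_triple_opp l x y h : sl2_triple l x y h -> sl2_triple (- l) y x (- h).
Proof.
move=> [xl yl xyh lh]; split=> //; first by rewrite opprK.
  by rewrite lieC xyh linearN.
by rewrite linearN /= opp_lfunE opprK.
Qed.

Lemma sl2_root l x y h : sl2_triple l x y h -> l != 0.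
Proof.
by move=> [_ _ _ lh]; apply/lfunPn; exists h; rewrite lh zero_lfunE pnatr_eq0.
Qed.

Lemma sl2_weight l m x y h u : sl2_triple l x y h -> weight_space m u -> u != 0 ->
  [lie x, [lie y, u]] = 0 -> exists k : nat, (m h : F) = - k%:R.
Proof.
move=> s um u0 xyu; have l0 := sl2_root s; have [xl yl xyh lh] := s.
have [k p] := string_weight xl um xyh xyu l0 u0; exists k; apply/eqP; move/eqP: p.
by rewrite lh mulrC -mulrDl mulf_eq0 pnatr_eq0 orbF addr_eq0.
Qed.

Lemma root_space_line l x z : is_root l -> weight_space l x -> x != 0 ->
  weight_space l z -> exists c, z = c *: x.
Proof.
move=> rl xl x0 zl; have [y [h s]] := sl2_triple_exists rl xl x0.
have l0 := rl.1; have [_ yl xyh lh] := s.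
have kxy : killing e x y != 0.
  apply/eqP => k0; have := lh; rewrite (@cartan_nondeg h).
    by rewrite linear0 => /esym/eqP; rewrite pnatr_eq0.
  by move=> h'; rewrite (killing_coroot _ xl xyh) k0 mulr0.
(* The part [u] of [z] orthogonal to [y] is a lowest weight vector of weight 2. *)
pose c := killing e z y / killing e x y; exists c; apply/eqP; rewrite -subr_eq0.
apply/negP => /negP u0; set u := z - c *: x in u0.
have ul : weight_space l u by rewrite /u -scaleNr; apply/weight_add/weight_scale.
have [h' uyh] := weight_bracket_opp ul yl.
have kuy : killing e u y = 0.
  by rewrite /u -scaleNr killingDl killingZl mulNr divfK // subrr.
have yu : [lie y, u] = 0.
  rewrite lieC uyh (@cartan_nondeg h') ?linear0 ?oppr0 // => h1.
  by rewrite (killing_coroot _ ul uyh) kuy mulr0.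
have [k] := sl2_weight s ul u0 (etrans (congr1 _ yu) (lie0r x)).
rewrite lh => /eqP; rewrite -addr_eq0 -natrD pnatr_eq0.
by rewrite add2n.
Qed.

(** A vector [u] of weight [2l] has [h]-weight 4, while [[y, u]] lies on the line of [x]. Hence [[x,
    [y, u]] = 0] even though [[y, u]] itself may be nonzero, and this already forces a nonpositive
    [h]-weight. *)
Lemma root_double l : is_root l -> ~ is_root (l + l).
Proof.
move=> rl [_ [u ul u0]]; have [x xl x0] := rl.2.
have [y [h s]] := sl2_triple_exists rl xl x0; have [_ yl xyh lh] := s.
have [c yu] : exists c, [lie y, u] = c *: x.
  by apply: (root_space_line rl) => //; rewrite -[l](addKr l); apply: weight_bracket.
have [|k] := sl2_weight s ul u0.
  by rewrite yu lieZr bracket_alternate scaler0.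
rewrite add_lfunE lh => /eqP; rewrite -addr_eq0 -!natrD pnatr_eq0.
by rewrite !addSn.
Qed.

(** Applying [y] as long as possible takes [k] steps and ends in a lowest vector, of [h]-weight
    [m(h) - 2k = -p]; from there [x] can be applied [p] times without reaching zero. *)
Lemma sl2_string l m x y h u : sl2_triple l x y h -> weight_space m u -> u != 0 ->
  exists k p : nat, (m h : F) = k%:R *+ 2 - p%:R /\
    forall j, (j <= p)%N -> exists i, lam i = m - l *+ k + l *+ j.
Proof.
move=> s um u0; have l0 := sl2_root s; have [xl yl xyh lh] := s.
have Nl0 : - l != 0 by rewrite oppr_eq0.
have ex0 : exists k, iter k (bracket y) u == 0.
  by have [k k0] := iter_nilpotent Nl0 yl um; exists k; apply/eqP.
case: (ex_minnP ex0) => -[|k] k0 k_min; first by move: k0; rewrite /= (negPf u0).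
set v := iter k (bracket y) u.
have v0 : v != 0 by apply/negP => /k_min; rewrite ltnn.
have yv : [lie y, v] = 0 by apply/eqP.
have vm := iter_weight k yl um.
have xyv : [lie x, [lie y, v]] = 0 by rewrite yv lie0r.
have [p vh] := sl2_weight s vm v0 xyv; exists k, p; split.
  move: vh; rewrite add_lfunE lfun_mulrnE opp_lfunE lh => <-.
  by rewrite mulNrn -mulrnA mulnC mulrnA addrCA subrr addr0.
move=> j jp; rewrite -mulNrn.
have vj0 : iter j (bracket x) v != 0.
  apply: (string_neq0 xl vm xyh xyv v0) => i ij.
  rewrite vh lh mulrC -mulrDl mulf_neq0 ?pnatr_eq0 // addrC subr_eq0 eqr_nat.
  by rewrite neq_ltn (leq_trans ij jp).
exact: (weight_lam e_basis e_weight vj0 (iter_weight j xl vm)).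
Qed.

Lemma sl2_reflection l m x y h : sl2_triple l x y h -> is_root m ->
  exists c : int, (m h : F) = c%:~R /\ is_root (m - l *~ c).
Proof.
move=> s [m0 [u um u0]]; have [_ _ _ lh] := s.
have [k [p [mh kp]]] := sl2_string s um u0.
have mhE : (m h : F) = (k%:Z *+ 2 - p%:Z)%:~R.
  by rewrite mh rmorphB rmorphMn.
exists (k%:Z *+ 2 - p%:Z); split=> //.
apply/(is_root_lam e_basis e_weight); split.
  apply/negP => /eqP /subr0_eq mE; case/eqP: m0.
  have := mhE; rewrite {1}mE; set c := (_ - _ : int) in mE *.
  rewrite lfun_mulrzE lh mulr2n mulrzDl => /eqP; rewrite -subr_eq0 addrK intr_eq0.
  by move=> /eqP c0; rewrite mE c0 mulr0z.
(* The reflected weight lies [p - k] steps above the bottom of the string. The inequality [k <= p]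
   is not established: in the other case the string of the opposite triple, read from its top,
   contains the reflected weight. *)
have [k_le_p|p_lt_k] := leqP k p.
  have [i iE] := kp (p - k)%N (leq_subr _ _); exists i; rewrite iE.
  rewrite -addrA; congr (_ + _).
  rewrite [l *+ k]pmulrn [l *+ (p - k)]pmulrn -!mulrNz -mulrzDr.
  by congr (_ *~ _); lia.
have [k' [p' [mh' kp']]] := sl2_string (sl2_triple_opp s) um u0.
have kk : (p' + p = k' * 2 + k * 2)%N.
  apply/eqP; rewrite -(eqr_nat F) !natrD !natrM !mulr_natr.
  move: mh'; rewrite linearN /= mh => /eqP.
  by rewrite -subr_eq0 => /eqP E; rewrite -subr_eq0 -[X in _ == X]E; apply/eqP; ring.
have [i iE] := kp' (p' - k')%N (leq_subr _ _); exists i; rewrite iE.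
rewrite -addrA; congr (_ + _).
rewrite mulNrn opprK mulNrn [l *+ k']pmulrn [l *+ (p' - k')]pmulrn -!mulrNz -mulrzDr.
by congr (_ *~ _); lia.
Qed.

End RootStrings.

(** * The root system of a simple Lie algebra *)

(* If [h] takes the value 1 on the base, all roots are nonzero integers on [h], so
   [killing h h] is a positive integer and Cartan's criterion is not needed. *)
Lemma killing_nondeg_of_base (F : numFieldType) (g : lieAlgType F) (t : {vspace g})
    (e : (dim g).-tuple g) (lam : 'I_(dim g) -> dual F t) (n : nat)
    (alpha : n.-tuple (dual F t)) (l : dual F t) :
  basis_of fullv e -> (forall i, weight_space (lam i) (tnth e i)) ->
  lie_simple g -> root_base alpha -> is_root l ->
  forall x, x != 0 -> exists i, killing e x (tnth e i) != 0.
Proof.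
move=> e_basis e_weight simple [alpha_free alpha_root alphaP] rl.
have [h hE] := free_functionals_eval (const_mx 1) alpha_free.
have sumE (c : 'I_n -> nat) : (\sum_i tnth alpha i *+ c i) h = (\sum_i c i)%:R :> F.
  rewrite sum_lfunE natr_sum; apply: eq_bigr => i _.
  by rewrite lfun_mulrnE hE mxE.
have hint m : is_root m -> exists2 k : int, (m h : F) = k%:~R & k != 0.
  move=> rm; have m0 := rm.1; have [c mc] := alphaP m rm.
  have c0 : (\sum_i c i)%N != 0.
    apply: contra_neq m0 => /eqP; rewrite sum_nat_eq0 => /forallP c0.
    have s0 : \sum_i tnth alpha i *+ c i = 0.
      by rewrite big1 // => i _; rewrite (eqP (implyP (c0 i) isT)).
    by case: mc => ->; rewrite s0 ?oppr0.
  case: mc => ->; [exists (\sum_i c i)%N%:Z|exists (- (\sum_i c i)%N%:Z)];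
    by rewrite ?opp_lfunE ?sumE ?mulrNz ?oppr_eq0 // ?eqz_nat.
apply: (killing_nondeg e_basis simple (h := h)).
rewrite (killing_cartan e_basis e_weight).
have sq i : 0 <= (lam i h : F) * lam i h.
  have [->|li0] := eqVneq (lam i) 0; first by rewrite zero_lfunE mul0r.
  have [|k -> _] := hint (lam i); last by rewrite -intrM ler0z -expr2 sqr_ge0.
  by split=> //; exists (tnth e i) => //; apply: (tnth_neq0 e_basis).
apply/eqP => /psumr_eq0P s0.
have [_ [i il]] := (is_root_lam e_basis e_weight l).1 rl.
have [k lk k0] := hint l rl.
have := s0 (fun i _ => sq i) i isT; rewrite il lk => /eqP.
by rewrite mulf_eq0 orbb intr_eq0 (negPf k0).
Qed.

(** * The invariant form and roots in coordinates *)

Section Form.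
Variables (R : realType) (n : nat) (G : 'M[R]_n).
Implicit Types x y z : 'rV[R]_n.

Lemma formDl x y z : form G (x + y) z = form G x z + form G y z.
Proof. by rewrite /Defs.form !mulmxDl mxE. Qed.

Lemma formZl a x y : form G (a *: x) y = a * form G x y.
Proof. by rewrite /Defs.form -!scalemxAl mxE. Qed.

Lemma formC x y : G^T = G -> form G x y = form G y x.
Proof.
by move=> GT; rewrite /Defs.form -{2}GT -{2}[y]trmxK -mulmxA -!trmx_mul [RHS]mxE.
Qed.

Lemma formNl x y : form G (- x) y = - form G x y.
Proof. by rewrite -scaleN1r formZl mulN1r. Qed.

Lemma form0l y : form G 0 y = 0.
Proof. by rewrite /Defs.form !mul0mx mxE. Qed.

Lemma formDr x y z : form G x (y + z) = form G x y + form G x z.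
Proof. by rewrite /Defs.form linearD mulmxDr mxE. Qed.

Lemma formZr a x y : form G x (a *: y) = a * form G x y.
Proof. by rewrite /Defs.form linearZ /= -scalemxAr mxE. Qed.

Lemma formNr x y : form G x (- y) = - form G x y.
Proof. by rewrite -scaleN1r formZr mulN1r. Qed.

Lemma form0r y : form G y 0 = 0.
Proof. by rewrite /Defs.form trmx0 mulmx0 mxE. Qed.

Lemma form_sumr x I (r : seq I) (P : pred I) (f : I -> 'rV[R]_n) :
  form G x (\sum_(i <- r | P i) f i) = \sum_(i <- r | P i) form G x (f i).
Proof. by apply: (big_morph _ (formDr x)); rewrite form0r. Qed.

End Form.

Lemma Re_int (R : realType) (c : int) : complex.Re (c%:~R : R[i]) = c%:~R.
Proof. by rewrite -(rmorph_int (real_complex R)). Qed.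

Section RootCoordinates.
Variables (R : realType) (g : lieAlgType R[i]) (t : {vspace g}) (n : nat).
Variable alpha : n.-tuple (dual R[i] t).
Local Notation V := 'rV[R]_n.
Implicit Types x y z : V.

Lemma weight_ofD x y : weight_of alpha (x + y) = weight_of alpha x + weight_of alpha y.
Proof.
rewrite /weight_of -big_split; apply: eq_bigr => i _.
by rewrite mxE raddfD scalerDl.
Qed.

Lemma weight_ofN x : weight_of alpha (- x) = - weight_of alpha x.
Proof.
rewrite /weight_of -sumrN; apply: eq_bigr => i _.
by rewrite mxE raddfN scaleNr.
Qed.

Lemma weight_of0 : weight_of alpha 0 = 0.
Proof. by rewrite -(subrr 0) weight_ofD weight_ofN subrr. Qed.

Lemma weight_ofMn x k : weight_of alpha (x *+ k) = weight_of alpha x *+ k.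
Proof. by elim: k => [|k IH]; rewrite ?weight_of0 // !mulrS weight_ofD IH. Qed.

Lemma weight_ofMz x (k : int) : weight_of alpha (x *~ k) = weight_of alpha x *~ k.
Proof. by case: k => k; rewrite ?NegzE ?mulrNz ?weight_ofN -!pmulrn weight_ofMn. Qed.

Lemma weight_of_sum I (r : seq I) (P : pred I) (f : I -> V) :
  weight_of alpha (\sum_(i <- r | P i) f i) = \sum_(i <- r | P i) weight_of alpha (f i).
Proof. by apply: (big_morph _ weight_ofD); apply: weight_of0. Qed.

Lemma weight_of_simple i : weight_of alpha (simple_root R i) = tnth alpha i.
Proof.
rewrite /weight_of (bigD1 i) //= big1 => [|j ji]; rewrite mxE eqxx /=.
  by rewrite eqxx addr0 scale1r.
by rewrite (negPf ji) scale0r.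
Qed.

Hypothesis alpha_base : root_base alpha.

Lemma weight_of_inj : injective (weight_of alpha).
Proof.
move=> x y xy; apply/eqP; rewrite -subr_eq0; apply/eqP/rowP => i; rewrite [RHS]mxE.
have [/freeP fr _ _] := alpha_base.
have /fr/(_ i) : \sum_i ((x - y) 0 i)%:C%C *: alpha`_i = 0.
  have := weight_ofD x (- y); rewrite weight_ofN xy subrr => E.
  rewrite -[RHS]E; apply: eq_bigr => j _; by rewrite -tnth_nth.
by case.
Qed.

Lemma root_leP x y :
  root_le x y <-> forall i, exists c : nat, y 0 i = x 0 i + c%:R.
Proof.
have sumE (c : 'I_n -> nat) i : (\sum_j simple_root R j *+ c j) 0 i = (c i)%:R.
  rewrite summxE (bigD1 i) //= big1 => [|j ji].
    by rewrite mulmxnE mxE !eqxx addr0.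
  by rewrite mulmxnE mxE eqxx [i == j]eq_sym (negPf ji) mul0rn.
split=> [[c yx] i|/choice[c cE]].
  by exists (c i); rewrite -sumE -yx !mxE addrCA subrr addr0.
exists c; apply/rowP => i; rewrite sumE !mxE cE; ring.
Qed.

Lemma Delta_sign x : Delta alpha x -> root_le 0 x \/ root_le 0 (- x).
Proof.
move=> rx; have [_ _ /(_ _ rx)[c xc]] := alpha_base.
have sE : weight_of alpha (\sum_i simple_root R i *+ c i) = \sum_i tnth alpha i *+ c i.
  by rewrite weight_of_sum; apply: eq_bigr => i _; rewrite weight_ofMn weight_of_simple.
by case: xc => xc; [left|right]; exists c; apply: weight_of_inj;
  rewrite subr0 sE -?xc // weight_ofN xc opprK.
Qed.

Lemma Delta_simple i : Delta alpha (simple_root R i).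
Proof. by rewrite /Delta /= weight_of_simple; case: alpha_base. Qed.

Lemma Delta0 : ~ Delta alpha 0.
Proof. by rewrite /Delta /= weight_of0; case; rewrite eqxx. Qed.

Hypotheses (g_simple : lie_simple g) (t_cartan : cartan_subalgebra t).
Variables (e : (dim g).-tuple g) (lam : 'I_(dim g) -> dual R[i] t).
Hypothesis e_basis : basis_of fullv e.
Hypothesis e_weight : forall i, weight_space (lam i) (tnth e i).

Lemma DeltaN x : Delta alpha x -> Delta alpha (- x).
Proof.
move=> rx; have kn := killing_nondeg_of_base e_basis e_weight g_simple alpha_base rx.
by rewrite /Delta /= weight_ofN; apply: (root_opp e_basis e_weight kn).
Qed.

Lemma Delta_double x : Delta alpha x -> ~ Delta alpha (x + x).
Proof.
move=> rx; have kn := killing_nondeg_of_base e_basis e_weight g_simple alpha_base rx.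
by rewrite /Delta /= weight_ofD; apply: (root_double e_basis e_weight t_cartan kn).
Qed.

Lemma Delta_coroot x : Delta alpha x -> exists2 h, is_coroot alpha x h &
  forall y, Delta alpha y ->
    exists c : int, (weight_of alpha y h : R[i]) = c%:~R /\ Delta alpha (y - x *~ c).
Proof.
move=> rx; have kn := killing_nondeg_of_base e_basis e_weight g_simple alpha_base rx.
have [u xu u0] := rx.2.
have [v [h s]] := sl2_triple_exists e_basis e_weight t_cartan kn rx xu u0.
exists h.
  have [_ yv uvh xh] := s; split=> //; exists u, v; split=> //.
  by rewrite /root_space /= weight_ofN.
move=> y ry; have [c [yh ryc]] := sl2_reflection e_basis e_weight s ry.
by exists c; split=> //; rewrite /Delta /= weight_ofD weight_ofN weight_ofMz.
Qed.

Variable G : 'M[R]_n.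
Hypothesis G_inner : invariant_inner_product alpha G.

(** Invariance of [G] under the reflection in [x], which negates [x], identifies the integer [y(h)]
    supplied by the sl2 triple with [2 (x, y) / (x, x)]. *)
Lemma Delta_reflection x y : Delta alpha x -> Delta alpha y ->
  exists2 c : int, 2 * form G x y = c%:~R * form G x x & Delta alpha (y - x *~ c).
Proof.
move=> rx ry; have [h xh yP] := Delta_coroot rx.
have [c [yh ryc]] := yP y ry; exists c => //.
have [GT _ GW] := G_inner.
pose s z := z - complex.Re (weight_of alpha z h : R[i]) *: x.
have sW : weyl_group alpha (s \o id).
  by apply: generated_comp; [exists x, h | apply: generated_id].
have := GW _ sW x y; rewrite /comp /=.
have -> : s x = - x.
  rewrite /s xh.1 (pmulrn 1 2) Re_int scaler_int -pmulrn mulr2n opprD addrA.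
  by rewrite subrr add0r.
have -> : s y = y - c%:~R *: x.
  by rewrite /s yh Re_int.
rewrite formNl formDr formNr formZr => E; lra.
Qed.

End RootCoordinates.

(** The interface between the Lie algebra and the combinatorics. The simple roots are the standard
    basis of the coordinate space, irreducibility is present as the existence of a highest root, and
    [rs_double] yields reducedness through [root_multiple]. *)
Record based_root_system (R : realType) (n : nat) (D : set 'rV[R]_n) (G : 'M[R]_n)
    (theta : 'rV[R]_n) : Prop := BasedRootSystem {
  rs_sign : forall x, D x -> root_le 0 x \/ root_le 0 (- x);
  rs_simple : forall i, D (simple_root R i);
  rs_neq0 : ~ D 0;
  rs_opp : forall x, D x -> D (- x);
  rs_double : forall x, D x -> ~ D (x + x);
  rs_refl : forall x y, D x -> D y ->
    exists2 c : int, 2 * form G x y = c%:~R * form G x x & D (y - x *~ c);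
  rs_form_tr : G^T = G;
  rs_form_pos : forall x, x != 0 -> 0 < form G x x;
  rs_theta : D theta;
  rs_theta_max : forall x, D x -> root_le 0 x -> root_le x theta
}.

(** * Positive roots, heights and the highest root *)

Section RootSystem.
Variables (R : realType) (n : nat) (D : set 'rV[R]_n) (G : 'M[R]_n) (theta : 'rV[R]_n).
Hypothesis rs : based_root_system D G theta.
Implicit Types x y z mu nu : 'rV[R]_n.
Local Notation "x <=r y" := (@root_le R n x y) (at level 70).
Local Notation B := (form G).
Local Notation sr := (@simple_root R n).

Lemma root_le_refl x : x <=r x.
Proof. by apply/root_leP => i; exists 0%N; rewrite addr0. Qed.

Lemma root_le_trans y x z : x <=r y -> y <=r z -> x <=r z.
Proof.
move=> /root_leP xy /root_leP yz; apply/root_leP => i.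
have [c ->] := yz i; have [d ->] := xy i.
by exists (d + c)%N; rewrite natrD addrA.
Qed.

Lemma root_le_coord x y i : x <=r y -> x 0 i <= y 0 i.
Proof. by move=> /root_leP/(_ i)[c ->]; rewrite lerDl ler0n. Qed.

Lemma root_le_anti x y : x <=r y -> y <=r x -> x = y.
Proof.
move=> xy yx; apply/rowP => i; apply/eqP.
by rewrite eq_le !root_le_coord.
Qed.

Lemma root_leN x : 0 <=r x -> 0 <=r - x -> x = 0.
Proof.
move=> x0 nx0; apply/rowP => i; apply/eqP; rewrite mxE eq_le.
by have := root_le_coord i x0; have := root_le_coord i nx0;
  rewrite !mxE oppr_ge0 => -> ->.
Qed.

Lemma root_neq0 x : D x -> x != 0.
Proof. by move=> Dx; apply/eqP => x0; apply: (rs_neq0 rs); rewrite -x0. Qed.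

Lemma root_norm x : D x -> 0 < B x x.
Proof. by move=> /root_neq0; apply: rs_form_pos rs _. Qed.

Lemma root_formC x y : B x y = B y x.
Proof. exact/formC/(rs_form_tr rs). Qed.

Lemma simple_coord i j : sr i 0 j = (j == i)%:R.
Proof. by rewrite mxE eqxx. Qed.

Lemma root_expand x : x = \sum_i x 0 i *: sr i.
Proof.
apply/rowP => j; rewrite summxE (bigD1 j) //= big1 => [|i ij].
  by rewrite mxE simple_coord eqxx mulr1 addr0.
by rewrite mxE simple_coord eq_sym (negPf ij) mulr0.
Qed.

Lemma form_expand x y : B x y = \sum_i y 0 i * B x (sr i).
Proof. by rewrite {1}[y]root_expand form_sumr; apply: eq_bigr => i _;
  rewrite formZr. Qed.

Lemma pos_coord x i : 0 <=r x -> 0 <= x 0 i.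
Proof. by move=> /root_le_coord; move=> /(_ i); rewrite mxE. Qed.

Lemma root_coord_pos x i : D x -> 0 < x 0 i -> 0 <=r x.
Proof.
by move=> Dx xi; have [//|/(pos_coord i)] := rs_sign rs Dx; rewrite mxE; lra.
Qed.

Lemma simple_pos i : 0 <=r sr i.
Proof. by apply: (@root_coord_pos _ i);
  [apply: rs_simple rs _|rewrite simple_coord eqxx]. Qed.

Lemma pos_root_coord x : D x -> 0 <=r x -> exists i, 0 < x 0 i.
Proof.
move=> Dx x0; apply: contrapT => /forallNP xn; case: (rs_neq0 rs).
suff <- : x = 0 by [].
apply/rowP => i; rewrite mxE; have := pos_coord i x0; have := xn i.
by move/negP; rewrite -leNgt => h1 h2; apply/eqP; rewrite eq_le h1.
Qed.

(** If one of the two Cartan integers is -1, a reflection gives [x + y]. If both were at most -2,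
    then [(x + y, x + y)] would not be positive. *)
Lemma root_obtuse x y : D x -> D y -> B x y < 0 -> x + y != 0 -> D (x + y).
Proof.
move=> Dx Dy xy0 xy; have [c cE Dc] := rs_refl rs Dx Dy.
have [d dE Dd] := rs_refl rs Dy Dx.
have nx := root_norm Dx; have ny := root_norm Dy.
have neg (a : int) (u v : R) : u < 0 -> 0 < v -> 2 * u = a%:~R * v ->
    a = -1 \/ 2 * u <= - 2 * v.
  move=> u0 v0 E; have a0 : a < 0 by rewrite -(ltrz0 R); nra.
  have [->|a1] := eqVneq a (-1); [by left|right].
  have : a <= -2 by lia.
  rewrite -(ler_int R) E; nra.
have [c1|c2] := neg _ _ _ xy0 nx cE.
  by move: Dc; rewrite c1 mulrNz opprK mulr1z addrC.
have yx0 : B y x < 0 by rewrite root_formC.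
have [d1|d2] := neg _ _ _ yx0 ny dE.
  by move: Dd; rewrite d1 mulrNz opprK mulr1z.
have := rs_form_pos rs xy; rewrite formDl !formDr (root_formC y x).
by rewrite (root_formC y x) in d2; lra.
Qed.

Lemma root_acute x y : D x -> D y -> 0 < B x y -> x != y -> D (x - y).
Proof.
move=> Dx Dy xy0 xy; apply: root_obtuse => //; first exact: rs_opp rs _ _.
  by rewrite formNr; lra.
by rewrite subr_eq0.
Qed.

(** The two Cartan integers of [x] and [a x] are [2 a] and [2 / a], with product 4, so [a] is 1/2, 1
    or 2; the outer values contradict [rs_double]. *)
Lemma root_multiple x (a : R) : D x -> D (a *: x) -> 0 < a -> a = 1.
Proof.
move=> Dx Dax a0; have [c cE _] := rs_refl rs Dx Dax.
have [d dE _] := rs_refl rs Dax Dx; have nx := root_norm Dx.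
move: cE dE; rewrite formZr !formZl formZr => cE dE.
have ca : c%:~R = 2 * a by apply: (mulIf (lt0r_neq0 nx)); rewrite -cE; ring.
have da : d%:~R * a = 2.
  by apply: (mulIf (lt0r_neq0 (mulr_gt0 a0 nx))); rewrite -mulrA -dE.
have cd : c * d = 4.
  apply/eqP; rewrite -(eqr_int R) intrM ca; apply/eqP.
  by rewrite -mulrA (mulrC a) da -natrM.
have c0 : 0 < c by rewrite -(ltr0z R) ca; lra.
have d0 : 0 < d by rewrite -(ltr0z R); nra.
have c4 : c <= 4 by nia.
have [c1|[c2|c4']] : c = 1 \/ c = 2 \/ c = 4 by nia.
- have aE : a = 1 / 2 by move: ca; rewrite c1; lra.
  case: (rs_double rs Dax); rewrite -scalerDl aE.
  by have -> : 1 / 2 + 1 / 2 = 1 :> R; [lra|rewrite scale1r].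
- by move: ca; rewrite c2 -[2%:~R]/(2%:R); lra.
- have aE : a = 2 by move: ca; rewrite c4' -[4%:~R]/(4%:R); lra.
  by case: (rs_double rs Dx); rewrite -mulr2n -scaler_nat -aE.
Qed.

Lemma refl_simple_pos x i (c : int) : D x -> 0 <=r x -> x <> sr i ->
  D (x - sr i *~ c) -> 0 <=r x - sr i *~ c.
Proof.
move=> Dx x0 xi Dxc; apply: contrapT => xn.
have coordE j : j != i -> (x - sr i *~ c) 0 j = x 0 j.
  by move=> ji; rewrite -scaler_int !mxE eqxx (negPf ji) mulr0 subr0.
apply: xi; have xE : x = x 0 i *: sr i.
  apply/rowP => j; rewrite mxE simple_coord; case: eqVneq => [->|ji];
    first by rewrite mulr1.
  rewrite mulr0; apply/eqP; rewrite eq_le pos_coord // andbT leNgt; apply/negP => xj.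
  by apply/xn/(root_coord_pos (i := j)); rewrite ?coordE.
have [j xj] := pos_root_coord Dx x0.
suff xi1 : x 0 i = 1 by rewrite xE xi1 scale1r.
apply: (@root_multiple (sr i)); [exact: rs_simple rs _|by rewrite -xE|].
have xjE : x 0 j = x 0 i * (j == i)%:R by rewrite {1}xE mxE simple_coord.
by move: xj; rewrite xjE; case: eqVneq => _; rewrite ?mulr1 // mulr0 ltxx.
Qed.

Definition height x : R := \sum_i x 0 i.

Lemma heightD x y : height (x + y) = height x + height y.
Proof. by rewrite /height -big_split; apply: eq_bigr => i _; rewrite mxE. Qed.

Lemma heightN x : height (- x) = - height x.
Proof. by rewrite /height -sumrN; apply: eq_bigr => i _; rewrite mxE. Qed.

Lemma heightZ a x : height (a *: x) = a * height x.
Proof. by rewrite /height mulr_sumr; apply: eq_bigr => i _; rewrite mxE. Qed.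

Lemma height0 : height 0 = 0.
Proof. by rewrite /height big1 // => i _; rewrite mxE. Qed.

Lemma height_simple i : height (sr i) = 1.
Proof.
rewrite /height (bigD1 i) //= big1 => [|j ji]; first by rewrite simple_coord eqxx addr0.
by rewrite simple_coord (negPf ji).
Qed.

Lemma root_le_height x y : x <=r y -> exists k : nat, height y = height x + k%:R.
Proof.
move=> /root_leP/choice[c cE]; exists (\sum_i c i)%N.
by rewrite natr_sum -big_split; apply: eq_bigr => i _; rewrite cE.
Qed.

Lemma pos_height x : D x -> 0 <=r x -> 0 < height x.
Proof.
move=> Dx x0; have [i xi] := pos_root_coord Dx x0.
rewrite /height (bigD1 i) //= ltr_wpDr // sumr_ge0 // => j _; exact: pos_coord.
Qed.

Lemma theta_pos : 0 <=r theta.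
Proof.
have [//|N] := rs_sign rs (rs_theta rs).
have := rs_theta_max rs (rs_opp rs (rs_theta rs)) N => /(root_le_trans N).
by move=> /root_leN/(_ N) t0; case: (rs_neq0 rs); rewrite -t0; apply: rs_theta rs.
Qed.

Lemma theta_dominant x : D x -> 0 <=r x -> 0 <= B x theta.
Proof.
move=> Dx x0; rewrite leNgt; apply/negP => neg.
have nz : x + theta != 0.
  apply/eqP => E; have := root_le_coord _ theta_pos.
  have [i xi] := pos_root_coord Dx x0 => /(_ i); rewrite mxE.
  by have : (x + theta) 0 i = 0 by [rewrite E mxE|]; rewrite mxE; lra.
have Dxt := root_obtuse Dx (rs_theta rs) neg nz.
have [i xi] := pos_root_coord Dx x0.
have ti := pos_coord i theta_pos.
have xt : 0 <=r x + theta by apply: (@root_coord_pos _ i) => //; rewrite mxE; lra.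
by have := root_le_coord i (rs_theta_max rs Dxt xt); rewrite mxE; lra.
Qed.

Lemma form_refl x y (c : int) : 2 * B x y = c%:~R * B x x ->
  B (y - x *~ c) (y - x *~ c) = B y y.
Proof.
rewrite -scaler_int => E.
rewrite formDl formDr (formDr _ (- _)) !formNl !formNr !formZl !formZr (root_formC y x).
have /= := congr1 (fun u => c%:~R * u) E; lra.
Qed.

(** For a dominant root [x] below [theta], [(x, x) <= (x, theta) <= (theta, theta)]. A positive root
    that is not dominant is reflected upwards without changing its norm, so induction runs on the
    height of [theta - x]. *)
Lemma theta_long x : D x -> B x x <= B theta theta.
Proof.
move=> Dx; wlog x0 : x Dx / 0 <=r x.
  move=> H; have [/(H x Dx)//|/(H _ (rs_opp rs Dx))] := rs_sign rs Dx.
  by rewrite formNl formNr opprK.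
have [k] := root_le_height (rs_theta_max rs Dx x0).
elim/ltn_ind: k => k IH in x Dx x0 * => hE.
have [dom|] := pselect (forall i, 0 <= B x (sr i)).
  have d i : 0 <= (theta - x) 0 i.
    by have := root_le_coord i (rs_theta_max rs Dx x0); rewrite !mxE; lra.
  have h1 : 0 <= B x (theta - x).
    by rewrite form_expand sumr_ge0 // => i _; rewrite mulr_ge0.
  have h2 : 0 <= B theta (theta - x).
    rewrite form_expand sumr_ge0 // => i _; rewrite mulr_ge0 // root_formC.
    by apply: theta_dominant; [apply: rs_simple rs _|apply: simple_pos].
  by move: h1 h2; rewrite !formDr !formNr (root_formC theta x); lra.
move=> /existsNP[i /negP]; rewrite -ltNge => xi.
have [c cE Dc] := rs_refl rs (rs_simple rs i) Dx.
have c0 : c < 0.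
  by rewrite -(ltrz0 R); have := root_norm (rs_simple rs i); move: cE;
    rewrite root_formC; nra.
have xsi : x <> sr i by move=> E; have := root_norm Dx; rewrite {2}E; lra.
have x'0 := refl_simple_pos Dx x0 xsi Dc.
have [k' hk'] := root_le_height (rs_theta_max rs Dc x'0).
rewrite -(form_refl cE); apply: (IH k') => //.
move: hk'; rewrite hE heightD heightN -scaler_int heightZ height_simple mulr1 => E.
have : (k : int)%:~R = (k' : int)%:~R - c%:~R :> R by rewrite -!pmulrn; lra.
by rewrite -rmorphB /= => /eqP; rewrite eqr_int => /eqP; lia.
Qed.

(** * Long roots and reflections between them *)

Definition long x := D x /\ forall y, D y -> B y y <= B x x.

(** A Cartan integer of at least 2 would make [(y - x, y - x)] nonpositive, because [x] is long. *)
Lemma long_pair x y : long x -> D y -> 0 < B x y -> y <> x -> 2 * B x y = B x x.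
Proof.
move=> [Dx xl] Dy xy yx; have [c cE _] := rs_refl rs Dx Dy.
have nx := root_norm Dx; have ny := xl y Dy.
have c0 : 0 < c by rewrite -(ltr0z R); nra.
have [c1|c2] := leP c 1.
  by have c1' : c = 1 by [lia|]; rewrite cE c1' mul1r.
exfalso; have {}c2 : 2 <= c by lia.
move: c2; rewrite -(ler_int R) => c2.
have yx0 : y - x != 0 by rewrite subr_eq0; apply/eqP.
have := rs_form_pos rs yx0; rewrite formDl !formDr !formNl !formNr (root_formC y x).
by move: cE c2; rewrite -[2%:~R]/(2%:R) => ? ?; nra.
Qed.

(* In terms of coroots: [mu^vee] is an integral combination of the simple coroots. *)
Lemma long_coord mu i : long mu -> 0 <=r mu ->
  exists k : int, mu 0 i * B (sr i) (sr i) = k%:~R * B mu mu.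
Proof.
move=> mul mu0; have [h] := root_le_height mu0.
rewrite height0 add0r.
elim/ltn_ind: h => h IH in mu mul mu0 * => hE; have [Dmu mu_max] := mul.
have [j /andP[mj bj]] : exists j, (0 < mu 0 j) && (0 < B mu (sr j)).
  apply: contrapT => /forallNP nj; have := root_norm Dmu.
  rewrite form_expand ltNge => /negP; apply; apply: sumr_le0 => j _.
  have /negP := nj j; rewrite negb_and -!leNgt => /orP[h1|h1].
    have := pos_coord j mu0 => h2; have -> : mu 0 j = 0 by apply/eqP; rewrite eq_le h1.
    by rewrite mul0r.
  by rewrite mulr_ge0_le0 ?pos_coord.
have [muj|muj] := pselect (mu = sr j).
  exists (i == j)%:Z; rewrite muj simple_coord; case: eqVneq => [->//|_].
  by rewrite !mul0r.
have [c cE Dc] := rs_refl rs (rs_simple rs j) Dmu.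
have nj := root_norm (rs_simple rs j).
have c0 : 0 < c by rewrite -(ltr0z R); move: cE; rewrite root_formC; nra.
have mu'0 := refl_simple_pos Dmu mu0 muj Dc.
have nE := form_refl cE.
have mu'l : long (mu - sr j *~ c) by split=> // y; rewrite nE; apply: mu_max.
have [h' hE'] := root_le_height mu'0.
rewrite height0 add0r in hE'.
have [|k] := IH h' _ _ mu'l mu'0 hE'.
  move: hE'; rewrite heightD heightN hE -scaler_int heightZ height_simple mulr1 => E.
  have : (h : int)%:~R = (h' : int)%:~R + c%:~R :> R by rewrite -!pmulrn; lra.
  by rewrite -rmorphD /= => /eqP; rewrite eqr_int => /eqP; lia.
rewrite nE -scaler_int !mxE eqxx /=; case: eqVneq => [ij|_]; last first.
  by rewrite mulr0 subr0 => ->; exists k.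
(* The reflection lowers the coordinate by [c], and [c (alpha_i, alpha_i) = (mu, mu)] by
   [long_pair], so the multiple drops by exactly one. *)
rewrite mulr1 ij => E; exists (k + 1).
have := long_pair mul (rs_simple rs j) bj (fun E => muj (esym E)).
by rewrite root_formC cE rmorphD /= => E2; rewrite mulrDl mul1r -E -E2; ring.
Qed.

Definition long_pos x := long x /\ 0 <=r x.

Lemma long_norm x y : long x -> long y -> B x x = B y y.
Proof. by move=> [Dx xl] [Dy yl]; apply/eqP; rewrite eq_le xl ?yl. Qed.

(* Both sides of the conclusion are integral multiples of
   [(nu, nu) / (alpha_i, alpha_i)]. *)
Lemma simple_step mu nu i (a : int) : long_pos mu -> long_pos nu -> mu <=r nu ->
  mu 0 i < nu 0 i -> a%:~R * B (sr i) (sr i) = B nu nu -> a%:~R <= nu 0 i - mu 0 i.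
Proof.
move=> [mul mu0] [nul nu0] munu lti aE.
have [k kE] := long_coord i mul mu0; have [l lE] := long_coord i nul nu0.
have ni := root_norm (rs_simple rs i).
have E : (nu 0 i - mu 0 i) * B (sr i) (sr i) = (l - k)%:~R * B nu nu.
  by rewrite mulrBl lE kE (long_norm mul nul) rmorphB mulrBl.
have nn := root_norm nul.1.
have lk : 1 <= (l - k)%:~R :> R.
  rewrite -[1]/(1%:~R) ler_int -gtz0_ge1 -(ltr0z R); have : 0 < nu 0 i - mu 0 i by lra.
  nra.
by nra.
Qed.

Lemma long_pos_refl nu i (a : int) : long_pos nu ->
  2 * B (sr i) nu = a%:~R * B (sr i) (sr i) ->
  nu <> sr i -> D (nu - sr i *~ a) -> long_pos (nu - sr i *~ a).
Proof.
move=> [nul nu0] aE nui Da; split; last exact: refl_simple_pos nul.1 nu0 nui Da.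
by split=> // y Dy; rewrite (form_refl aE); apply: nul.2.
Qed.

Lemma root_le_sub mu nu i (a : int) : mu <=r nu -> 0 <= a -> a%:~R <= nu 0 i - mu 0 i ->
  mu <=r nu - sr i *~ a.
Proof.
move=> munu a0 ai; apply/root_leP => j; have /root_leP/(_ j)[c cE] := munu.
rewrite -scaler_int !mxE eqxx /=; case: eqVneq => [ji|_]; last first.
  by exists c; rewrite mulr0 subr0.
case: a a0 ai => // a _ ai; exists (c - a)%N.
have ac : (a <= c)%N by rewrite -(ler_nat R); move: ai; rewrite -ji cE -pmulrn; lra.
by rewrite natrB // cE mulr1 -pmulrn addrA.
Qed.

(** Equal norms give [(nu, nu - mu) > 0], so some [alpha_i] occurring in [nu - mu] pairs positively
    with [nu]. Reflecting in it lowers [nu], and [simple_step] ensures that the result is still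
    above [mu]. *)
Lemma down_step mu nu : long_pos mu -> long_pos nu -> mu <=r nu -> mu <> nu ->
  exists i (a : int), [/\ 0 < a, 2 * B (sr i) nu = a%:~R * B (sr i) (sr i),
    nu <> sr i, long_pos (nu - sr i *~ a) & mu <=r nu - sr i *~ a].
Proof.
move=> mup nup munu ne; have [[mul mu0] [nul nu0]] := (mup, nup).
have pos : 0 < B nu (nu - mu).
  have d0 : nu - mu != 0 by rewrite subr_eq0; apply/eqP => E; apply: ne.
  have := rs_form_pos rs d0;
    rewrite formDl !formDr !formNl !formNr (long_norm mul nul) (root_formC mu nu); lra.
have [i /andP[di bi]] : exists i, (0 < (nu - mu) 0 i) && (0 < B nu (sr i)).
  apply: contrapT => /forallNP ni; move: pos.
  rewrite form_expand ltNge => /negP; apply; apply: sumr_le0 => i _.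
  have d0 : 0 <= (nu - mu) 0 i by have := root_le_coord i munu; rewrite !mxE; lra.
  have /negP := ni i; rewrite negb_and -!leNgt => /orP[h1|h1].
    by have -> : (nu - mu) 0 i = 0; [apply/eqP; rewrite eq_le h1|rewrite mul0r].
  by rewrite mulr_ge0_le0.
rewrite !mxE in di.
have nui : nu <> sr i.
  move=> E; have [j mj] := pos_root_coord mul.1 mu0.
  have := root_le_coord j munu; rewrite E simple_coord.
  have [ji|_] := eqVneq j i; last by rewrite mulr0n leNgt mj.
  have /root_leP/(_ j)[c] := mu0; rewrite mxE add0r => cE _; move: mj di.
  rewrite E simple_coord eqxx mulr1n -ji cE; clear E ne.
  case: c {cE} => [|c]; first by rewrite ltxx.
  by rewrite mulrS => ? ?; have ? := ler0n R c; lra.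
have [a aE Da] := rs_refl rs (rs_simple rs i) nul.1.
have nn := root_norm (rs_simple rs i).
have lp := long_pair nul (rs_simple rs i) bi (fun E => nui (esym E)).
have a0 : 0 < a by rewrite -(ltr0z R); move: aE; rewrite root_formC; nra.
exists i, a; split=> //; first exact: long_pos_refl.
apply: root_le_sub => //; first exact: ltW.
by apply: simple_step => //; [lra|rewrite -aE root_formC].
Qed.

(** Dual to [down_step]: here [(mu, nu - mu) < 0], and [simple_step] bounds the jump [-a] by the
    room left below [nu]. *)
Lemma up_step mu nu : long_pos mu -> long_pos nu -> mu <=r nu -> mu <> nu ->
  exists i (a : int), [/\ a < 0, 2 * B (sr i) mu = a%:~R * B (sr i) (sr i),
    long_pos (mu - sr i *~ a) & mu - sr i *~ a <=r nu].
Proof.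
move=> mup nup munu ne; have [[mul mu0] [nul nu0]] := (mup, nup).
have neg : B mu (nu - mu) < 0.
  have d0 : nu - mu != 0 by rewrite subr_eq0; apply/eqP => E; apply: ne.
  have := rs_form_pos rs d0;
    rewrite formDl !formDr !formNl !formNr (long_norm mul nul) (root_formC mu nu); lra.
have [i /andP[di bi]] : exists i, (0 < (nu - mu) 0 i) && (B mu (sr i) < 0).
  apply: contrapT => /forallNP ni; move: neg.
  rewrite form_expand ltNge => /negP; apply; apply: sumr_ge0 => i _.
  have d0 : 0 <= (nu - mu) 0 i by have := root_le_coord i munu; rewrite !mxE; lra.
  have /negP := ni i; rewrite negb_and -!leNgt => /orP[h1|h1].
    by have -> : (nu - mu) 0 i = 0; [apply/eqP; rewrite eq_le h1|rewrite mul0r].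
  by rewrite mulr_ge0.
rewrite !mxE in di.
have mui : mu <> sr i by move=> E; have := root_norm mul.1; rewrite {2}E; lra.
have muNi : - sr i <> mu.
  move=> E; have := pos_coord i mu0; by rewrite -E mxE simple_coord eqxx oppr_ge0 ler10.
have [a aE Da] := rs_refl rs (rs_simple rs i) mul.1.
have nn := root_norm (rs_simple rs i).
have lp := long_pair mul (rs_opp rs (rs_simple rs i)) _ muNi.
rewrite formNr in lp; have {}lp := lp (ltac:(lra)).
have a0 : a < 0 by rewrite -(ltrz0 R); move: aE; rewrite root_formC; nra.
exists i, a; split=> //; first exact: long_pos_refl.
have : (- a)%:~R <= nu 0 i - mu 0 i.
  apply: simple_step => //; first lra.
  by rewrite (long_norm nul mul) -lp rmorphN /= mulNr -aE root_formC; ring.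
rewrite rmorphN /= => ai; apply/root_leP => j; have /root_leP/(_ j)[c cE] := munu.
rewrite -scaler_int !mxE eqxx /=; case: eqVneq => [ji|_]; last first.
  by exists c; rewrite mulr0 subr0.
case: a a0 ai {aE Da} => // a _; rewrite NegzE rmorphN /= opprK -pmulrn => ai.
have ac : (a.+1 <= c)%N by rewrite -(ler_nat R); move: ai; rewrite -ji cE; lra.
by exists (c - a.+1)%N; rewrite natrB // cE mulr1; ring.
Qed.

End RootSystem.

(** * The affine Weyl group *)

Section Affine.
Variables (R : realType) (g : lieAlgType R[i]) (t : {vspace g}) (n : nat).
Variables (alpha : n.-tuple (dual R[i] t)) (G : 'M[R]_n) (theta : 'rV[R]_n).
Local Notation D := (Delta alpha).
Hypothesis rs : based_root_system D G theta.
Local Notation V := 'rV[R]_n.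
Local Notation A := (affV R n).
Local Notation J := (option 'I_n).
Local Notation "x <=r y" := (@root_le R n x y) (at level 70).
Local Notation B := (form G).
Local Notation aB := (aff_form G).
Local Notation sr := (@simple_root R n).
Local Notation dl := (delta R n).
Local Notation av := (@affV_of R n).
Local Notation apos := (aff_Delta_pos alpha).
Implicit Types (x y z b : A) (r gam : V) (i : 'I_n) (j : J) (s u v : seq J).

Lemma aff_ext x y : x.1.1 = y.1.1 -> x.1.2 = y.1.2 -> x.2 = y.2 -> x = y.
Proof. by move: x y => [[x1 x2] x3] [[y1 y2] y3] /= -> -> ->. Qed.

Lemma dlMn k : dl *+ k = (0, k%:R, 0) :> A.
Proof.
elim: k => [|k IH]; first by rewrite mulr0n.
by rewrite mulrS IH; apply: aff_ext; rewrite /= ?addr0 // mulrS.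
Qed.

(* The index [None] stands for the affine simple root [alpha_0 = delta - theta]. *)
Definition asimple j : A := if j is Some i then av (sr i) else dl - av theta.

Definition srefl j := aff_reflection G (asimple j).

(** The head of a word acts last, so prefixing a letter is left multiplication, the direction in
    which inversion sets grow by one root. Words carry the inductions: their size plays the part of
    a length function. *)
Definition wact s x := foldr srefl x s.

Definition aff_root x := [/\ D x.1.1, exists k : int, x.1.2 = k%:~R & x.2 = 0].

(* Coordinates in the basis [alpha_0, ..., alpha_n], as [delta = alpha_0 + theta]. *)
Definition aff_coord j x : R :=
  if j is Some i then x.1.1 0 i + x.1.2 * theta 0 i else x.1.2.

Lemma aff_formDl x y z : aB (x + y) z = aB x z + aB y z.
Proof. by rewrite /aff_form /= formDl; ring. Qed.

Lemma aff_formZl a x y : aB (a *: x) y = a * aB x y.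
Proof. by rewrite /aff_form /= formZl -![_ *: _]/(_ * _); ring. Qed.

Lemma aff_formC x y : aB x y = aB y x.
Proof. by rewrite /aff_form (root_formC rs); ring. Qed.

Lemma aff_formDr x y z : aB z (x + y) = aB z x + aB z y.
Proof. by rewrite aff_formC aff_formDl !(aff_formC z). Qed.

Lemma aff_formZr a x y : aB y (a *: x) = a * aB y x.
Proof. by rewrite aff_formC aff_formZl (aff_formC y). Qed.

Lemma aff_formNl x y : aB (- x) y = - aB x y.
Proof. by rewrite -scaleN1r aff_formZl mulN1r. Qed.

Lemma aff_formNr x y : aB y (- x) = - aB y x.
Proof. by rewrite -scaleN1r aff_formZr mulN1r. Qed.

Lemma aff_form_root x y : x.2 = 0 -> y.2 = 0 -> aB x y = B x.1.1 y.1.1.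
Proof. by move=> x2 y2; rewrite /aff_form x2 y2 mulr0 mul0r !addr0. Qed.

Lemma asimple2 j : (asimple j).2 = 0.
Proof. by case: j => [i|] //=; rewrite subr0. Qed.

Lemma asimple_root j : aff_root (asimple j).
Proof.
case: j => [i|]; split=> //=; first exact: rs_simple rs i.
- by exists 0.
- by rewrite sub0r; apply: rs_opp rs _ (rs_theta rs).
- by exists 1; rewrite subr0.
- by rewrite subr0.
Qed.

Lemma aff_root_neq0 x : aff_root x -> aB x x != 0.
Proof.
by move=> [Dx _ x2]; rewrite aff_form_root // lt0r_neq0 //; apply: root_norm rs _ Dx.
Qed.

Lemma aff_rootN x : aff_root x -> aff_root (- x).
Proof.
move=> [Dx [k xk] x2]; split=> /=; first exact: rs_opp rs _ Dx.
  by exists (- k); rewrite xk rmorphN.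
by rewrite x2 oppr0.
Qed.

Lemma aff_coordD j x y : aff_coord j (x + y) = aff_coord j x + aff_coord j y.
Proof. by case: j => [i|] /=; rewrite ?mxE; ring. Qed.

Lemma aff_coordN j x : aff_coord j (- x) = - aff_coord j x.
Proof. by case: j => [i|] /=; rewrite ?mxE; ring. Qed.

Lemma aff_coordZ j a x : aff_coord j (a *: x) = a * aff_coord j x.
Proof. by case: j => [i|] /=; rewrite ?mxE -![_ *: _]/(_ * _); ring. Qed.

Lemma aff_coord_asimple j j' : aff_coord j' (asimple j) = (j' == j)%:R.
Proof.
by case: j j' => [i|] [i'|] //=;
  rewrite ?subr0 ?mul0r ?addr0 ?sub0r ?mxE ?mul1r ?addNr //.
Qed.

Lemma aff_coord_inj x y : x.2 = y.2 -> (forall j, aff_coord j x = aff_coord j y) ->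
  x = y.
Proof.
move=> xy2 xy; have xy1 := xy None; apply: aff_ext => //; apply/rowP => i.
by have := xy (Some i); rewrite /= (xy1 : x.1.2 = y.1.2) => /addIr.
Qed.

Lemma root_theta_bound r i : D r -> 0 <= r 0 i + theta 0 i.
Proof.
move=> Dr; have ti := pos_coord i (theta_pos rs).
have [r0|r0] := rs_sign rs Dr; first by rewrite addr_ge0 // pos_coord.
have := root_le_coord i (rs_theta_max rs (rs_opp rs Dr) r0).
by rewrite mxE; lra.
Qed.

(** Positivity becomes nonnegativity of the coordinates along [alpha_0, ..., alpha_n]. At level
    [k >= 1] this rests on [r + theta] having nonnegative coordinates for every root [r], by
    maximality of [theta]. *)
Lemma aposP x : apos x <-> aff_root x /\ forall j, 0 <= aff_coord j x.
Proof.
split.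
  case=> [[r [Dr r0] ->]|[r [k [Dr k1 ->]]]].
    split; first by split=> //=; exists 0.
    by case=> [i|] /=; rewrite ?mul0r ?addr0 //; apply: pos_coord.
  rewrite dlMn; split.
    by split=> /=; rewrite ?addr0 //; exists k%:Z; rewrite add0r.
  case=> [i|] /=; rewrite ?addr0 ?add0r // mulr_natl.
  have ti := pos_coord i (theta_pos rs).
  have := root_theta_bound i Dr; case: k k1 => // k _.
  rewrite mulrS addrA => h; apply: addr_ge0 => //.
  by rewrite mulrn_wge0.
move=> [[Dx [k xk] x2] x0]; have := x0 None; rewrite /= xk ler0z => k0.
case: k k0 xk => // -[|k] _ xk.
  left; exists x.1.1; last exact: aff_ext.
  split=> //; have [//|neg] := rs_sign rs Dx.
  case: (rs_neq0 rs); suff <- : x.1.1 = 0 by [].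
  apply/rowP => i; have := x0 (Some i); have := pos_coord i neg.
  by rewrite /= xk mul0r addr0 !mxE; lra.
right; exists x.1.1, k.+1; split=> //; rewrite dlMn.
by apply: aff_ext; rewrite /= ?addr0 ?add0r // xk.
Qed.

Lemma apos_root x : apos x -> aff_root x.
Proof. by move=> /aposP[]. Qed.

Lemma aposNP x : apos x -> apos (- x) -> False.
Proof.
move=> /aposP[[Dx _ x2] x0] /aposP[_ nx0]; apply: (rs_neq0 rs).
suff -> : 0 = x.1.1 by [].
suff -> : x = 0 by [].
apply: aff_coord_inj => // j; have := x0 j; have := nx0 j.
rewrite aff_coordN; have ->
  : aff_coord j 0 = 0 by rewrite -(scale0r x) aff_coordZ mul0r.
lra.
Qed.

Lemma apos_or x : aff_root x -> apos x \/ apos (- x).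
Proof.
move=> rx; have [Dx [k xk] x2] := rx.
have ge1 y : aff_root y -> 1 <= y.1.2 -> apos y.
  move=> ry y1; apply/aposP; split=> // -[i|] /=; last lra.
  have [Dy _ _] := ry; have := root_theta_bound i Dy.
  have ti := pos_coord i (theta_pos rs); nra.
have [k0|k0|k0] := ltgtP k 0.
- by right; apply: ge1;
  [exact: aff_rootN|rewrite /= xk -rmorphN -[1]/(1%:~R) ler_int; lia].
- by left; apply: ge1; rewrite // xk -[1]/(1%:~R) ler_int; lia.
have x12 : x.1.2 = 0 by rewrite xk k0.
have [x0|x0] := rs_sign rs Dx; [left|right]; apply/aposP; split=> //;
  try exact: aff_rootN.
  by case=> [i|] /=; rewrite x12 ?mul0r ?addr0 // pos_coord.
by case=> [i|] /=; rewrite x12 oppr0 ?mul0r ?addr0 // pos_coord.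
Qed.

Lemma apos_coord x j : aff_root x -> 0 < aff_coord j x -> apos x.
Proof.
move=> rx xj; have [//|/aposP[_ /(_ j)]] := apos_or rx.
by rewrite aff_coordN; lra.
Qed.

Lemma asimple_pos j : apos (asimple j).
Proof. by apply: (@apos_coord _ j);
  [exact: asimple_root|rewrite aff_coord_asimple eqxx]. Qed.

Lemma apos_other_coord x j : apos x -> x <> asimple j ->
  exists2 j', j' != j & 0 < aff_coord j' x.
Proof.
move=> /aposP[rx x0] xj; apply: contrapT => nj'; apply: xj.
have c0 j' : j' != j -> aff_coord j' x = 0.
  move=> jj'; apply/eqP; rewrite eq_le x0 andbT leNgt; apply/negP => h.
  by apply: nj'; exists j'.
have [Dx [k xk] x2] := rx.
have xE : x = aff_coord j x *: asimple j.
  apply: aff_coord_inj; first by rewrite x2 /= asimple2 scaler0.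
  move=> j'; rewrite aff_coordZ aff_coord_asimple; case: eqVneq => [->|/c0 ->].
    by rewrite mulr1.
  by rewrite mulr0.
set a := aff_coord j x in xE.
have a0 : 0 <= a by apply: x0.
have a1 : 0 < a.
  rewrite lt_neqAle a0 andbT; apply/eqP => aE; apply: (rs_neq0 rs).
  by move: Dx; rewrite xE -aE scale0r.
suff aE : a = 1 by rewrite xE aE scale1r.
have [Da _ _] := asimple_root j.
by apply: (root_multiple rs Da) => //; move: Dx; rewrite {1}xE.
Qed.

(** * Affine simple reflections and the exchange condition *)

Lemma sreflE j x :
  srefl j x = x - (2 * aB x (asimple j) / aB (asimple j) (asimple j)) *: asimple j.
Proof.
rewrite /srefl /aff_reflection /aff_coroot scalerA; congr (_ - _ *: _).
by rewrite mulrCA mulrA.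
Qed.

Lemma sreflD j x y : srefl j (x + y) = srefl j x + srefl j y.
Proof. by rewrite !sreflE aff_formDl mulrDr mulrDl scalerDl opprD addrACA. Qed.

Lemma sreflZ j a x : srefl j (a *: x) = a *: srefl j x.
Proof. by rewrite !sreflE aff_formZl scalerBr scalerA; congr (_ - _ *: _); ring. Qed.

Lemma srefl_form j x y : aB (srefl j x) (srefl j y) = aB x y.
Proof.
have a0 := aff_root_neq0 (asimple_root j).
rewrite !sreflE aff_formDl !aff_formDr !aff_formNl !aff_formNr !aff_formZl.
by rewrite !aff_formZr (aff_formC (asimple j) y); field; exact: a0.
Qed.

Lemma sreflK j : involutive (srefl j).
Proof.
move=> x; have a0 := aff_root_neq0 (asimple_root j).
rewrite [srefl j (_)]sreflE !sreflE aff_formDl aff_formNl aff_formZl -addrA -opprD -scalerDl.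
set c := (X in X *: asimple j); have -> : c = 0 by rewrite /c; field; exact: a0.
by rewrite scale0r subr0.
Qed.

Lemma srefl_asimple j : srefl j (asimple j) = - asimple j.
Proof.
have a0 := aff_root_neq0 (asimple_root j).
by rewrite sreflE mulfK // scaler_nat mulr2n opprD addrA subrr add0r.
Qed.

Lemma srefl_delta j : srefl j dl = dl.
Proof.
rewrite sreflE (_ : aB dl (asimple j) = 0) ?mulr0 ?mul0r ?scale0r ?subr0 //.
by rewrite /aff_form /= asimple2 form0l mulr0 mul0r !addr0.
Qed.

Lemma srefl_int j x : aff_root x -> exists c : int,
  [/\ 2 * aB x (asimple j) = c%:~R * aB (asimple j) (asimple j),
    srefl j x = x - asimple j *~ c
    & aff_root (srefl j x)].
Proof.
move=> [Dx [k xk] x2]; have [Da _ _] := asimple_root j;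
  have a0 := aff_root_neq0 (asimple_root j).
have [c cE Dc] := rs_refl rs Da Dx.
have aE : 2 * aB x (asimple j) = c%:~R * aB (asimple j) (asimple j).
  by rewrite !aff_form_root ?asimple2 // (root_formC rs).
have rE : srefl j x = x - asimple j *~ c by rewrite sreflE aE mulfK // scaler_int.
exists c; split=> //; rewrite rE -scaler_int; split=> /=.
- by rewrite scaler_int.
- have [_ [m ->] _] := asimple_root j; exists (k - c * m).
  by rewrite xk rmorphB rmorphM.
- by rewrite x2 asimple2 scaler0 subr0.
Qed.

Lemma srefl_root j x : aff_root x -> aff_root (srefl j x).
Proof. by move=> /srefl_int-/(_ j)[c []]. Qed.

Lemma srefl_apos j x : apos x -> x <> asimple j -> apos (srefl j x).
Proof.
move=> px xj; have [j' jj' xj'] := apos_other_coord px xj.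
apply: (@apos_coord _ j'); first exact/srefl_root/apos_root.
by rewrite sreflE aff_coordD aff_coordN aff_coordZ aff_coord_asimple (negPf jj') mulr0 subr0.
Qed.

Lemma wactD s x y : wact s (x + y) = wact s x + wact s y.
Proof. by elim: s => //= j s ->; rewrite sreflD. Qed.

Lemma wactZ s a x : wact s (a *: x) = a *: wact s x.
Proof. by elim: s => //= j s ->; rewrite sreflZ. Qed.

Lemma wactN s x : wact s (- x) = - wact s x.
Proof. by rewrite -scaleN1r wactZ scaleN1r. Qed.

Lemma wact_form s x y : aB (wact s x) (wact s y) = aB x y.
Proof. by elim: s => //= j s <-; rewrite srefl_form. Qed.

Lemma wact_delta s : wact s dl = dl.
Proof. by elim: s => //= j s ->; rewrite srefl_delta. Qed.

Lemma wact_root s x : aff_root x -> aff_root (wact s x).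
Proof. by move=> rx; elim: s => //= j s; apply: srefl_root. Qed.

Lemma wact_cat s u x : wact (s ++ u) x = wact s (wact u x).
Proof. exact: foldr_cat. Qed.

Lemma wact_revK s x : wact (rev s) (wact s x) = x.
Proof.
by elim: s x => //= j s IH x; rewrite rev_cons -cats1 wact_cat /= sreflK.
Qed.

Lemma wactK_rev s x : wact s (wact (rev s) x) = x.
Proof. by rewrite -{1}[s]revK wact_revK. Qed.

Lemma wact_refl s j x : wact s (srefl j x) =
  wact s x - (2 * aB (wact s x) (wact s (asimple j)) / aB (asimple j) (asimple j))
    *: wact s (asimple j).
Proof. by rewrite sreflE wactD wactN wactZ wact_form. Qed.

(** Reading the word from its right end, the image of [alpha_j] turns negative at some letter [k].
    Just before, it must be [alpha_k], so deleting that letter amounts to multiplying by [s_j] on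
    the right. *)
Lemma wact_exchange s j : apos (- wact s (asimple j)) ->
  exists2 s', (size s' < size s)%N & forall x, wact s' x = wact s (srefl j x).
Proof.
elim: s => [|k s IH] /=; first by move=> neg; case: (aposNP (asimple_pos j)).
set y := wact s (asimple j); have ry : aff_root y by apply/wact_root/asimple_root.
move=> neg; have [py|/IH[s' s's s'E]] := apos_or ry; last first.
  by exists (k :: s'); rewrite ?ltnS // => x /=; rewrite s'E.
have yk : y = asimple k.
  by apply: contrapT => yk; case: (aposNP (srefl_apos py yk) neg).
exists s => // x; rewrite wact_refl -/y yk -(wact_form s (asimple j)) -/y yk.
by rewrite -sreflE sreflK.
Qed.

(** If the word ends in [k], the part before [k] negates [alpha_k], and the exchange condition gives
    a shorter word with the same action; the induction ends at the empty word. *)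
Lemma wact_eq_id s : (forall j, apos (wact s (asimple j))) -> forall x, wact s x = x.
Proof.
have [m] := ubnP (size s); elim: m => // m IH in s *; rewrite ltnS => sm pos.
case/lastP: s => [//|s k] in sm pos *.
have [|s' s's s'E] := @wact_exchange s k.
  by have := pos k; rewrite -cats1 wact_cat /= srefl_asimple wactN.
move=> x; rewrite -cats1 wact_cat /= -s'E; apply: IH.
  by apply: leq_trans sm; rewrite size_rcons ltnS ltnW.
by move=> j; rewrite s'E; have := pos j; rewrite -cats1 wact_cat.
Qed.

(** * Inversion sets and the left weak order *)

Definition inversion s x := apos x /\ apos (- wact s x).

(** The reflection [s_j] keeps every positive root other than [alpha_j] positive, so the only change
    is at the root that [s] sends to [alpha_j]. *)
Lemma inversion_cons s j b : apos b -> wact s b = asimple j ->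
  forall x, inversion (j :: s) x <-> inversion s x \/ x = b.
Proof.
move=> pb sb x; rewrite /inversion /=; split=> [[px neg]|[[px neg]|->]].
- have [ps|ns] := apos_or (wact_root s (apos_root px)); last by left.
  right; rewrite -(wact_revK s x) -(wact_revK s b) sb; congr wact.
  by apply: contrapT => ne; case: (aposNP (srefl_apos ps ne) neg).
- split=> //; rewrite -scaleN1r -sreflZ scaleN1r; apply: srefl_apos => // E.
  suff xb : - x = b by apply: (aposNP px); rewrite xb.
  by rewrite -(wact_revK s (- x)) wactN E -sb wact_revK.
- by rewrite sb srefl_asimple opprK; split=> //; apply: asimple_pos.
Qed.

(* Induction along a chain of the left weak order from [s0] up to [s']. *)
Lemma inversion_chain (Q : seq J -> Prop) s0 s' :
  (forall x, inversion s0 x -> inversion s' x) -> Q s0 ->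
  (forall s j b, (forall x, inversion s x -> inversion s' x) -> Q s -> apos b ->
     wact s b = asimple j -> inversion s' b -> Q (j :: s)) ->
  exists2 s, Q s & forall x, wact s x = wact s' x.
Proof.
move=> sub0 Q0 step.
(* The word [u] represents [s' s0^-1]. A simple root negated by [u] is the image under [s0] of the
   next root [b] to be added, and the exchange condition shortens [u] accordingly; when none is
   negated, [u] acts trivially. *)
have: forall x, wact (s' ++ rev s0) (wact s0 x) = wact s' x.
  by move=> x; rewrite wact_cat wact_revK.
move: (s' ++ rev s0) => u uE.
have [m] := ubnP (size u); elim: m => // m IH in s0 u uE sub0 Q0 *; rewrite ltnS => um.
have [pos|/existsNP[j npos]] := pselect (forall j, apos (wact u (asimple j))).
  by exists s0 => // x; rewrite -uE (wact_eq_id pos).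
have neg : apos (- wact u (asimple j)).
  by have [//|] := apos_or (wact_root u (asimple_root j)).
set b := wact (rev s0) (asimple j);
  have s0b : wact s0 b = asimple j by apply: wactK_rev.
have rb : aff_root b by apply/wact_root/asimple_root.
have pb : apos b.
  have [//|nb] := apos_or rb; case: npos; rewrite -s0b uE.
  have [|_] := sub0 (- b); first by split; rewrite // wactN opprK s0b;
    apply: asimple_pos.
  by rewrite wactN opprK.
have [u' u'u u'E] := wact_exchange neg.
have inb : inversion s' b by split=> //; rewrite -uE s0b.
apply: (IH (j :: s0) u').
- by move=> x; rewrite u'E /= sreflK.
- by move=> x /(inversion_cons pb s0b)[/sub0//|->].
- exact: step sub0 Q0 pb s0b inb.
- exact: leq_trans u'u um.
Qed.

(** Expanding the positive number [(x, x)] along the affine simple roots yields an [alpha_j] that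
    occurs in [x] and pairs positively with it. The second alternative arises when [x] and [alpha_j]
    differ by a multiple of [delta]. *)
Lemma apos_nonsimple x : apos x -> (forall j, x <> asimple j) ->
  exists j, apos (x - asimple j) \/ exists m, x - asimple j = dl *+ m.+1.
Proof.
move=> px nx; have /aposP[[Dx [k xk] x2] x0] := px.
have [j /andP[cj bj]] : exists j, (0 < aff_coord j x) && (0 < B x.1.1 (asimple j).1.1).
  apply: contrapT => /forallNP nj; have := root_norm rs Dx.
  have le0 j : aff_coord j x * B x.1.1 (asimple j).1.1 <= 0.
    have /negP := nj j; rewrite negb_and -!leNgt => /orP[h|h].
      by have -> : aff_coord j x = 0; [apply/eqP; rewrite eq_le h x0|rewrite mul0r].
    by rewrite mulr_ge0_le0.
  have E : B x.1.1 x.1.1 = \sum_i aff_coord (Some i) x * B x.1.1 (sr i)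
      - x.1.2 * B x.1.1 theta.
    rewrite {1}form_expand (form_expand _ _ theta) mulr_sumr -sumrB.
    by apply: eq_bigr => i _ /=; ring.
  rewrite E ltNge => /negP; apply.
  have s0 : \sum_i aff_coord (Some i) x * B x.1.1 (sr i) <= 0.
    by apply: sumr_le0 => i _; apply: (le0 (Some i)).
  by have := le0 None; rewrite /= sub0r formNr; lra.
exists j; have [Da [m am] _] := asimple_root j.
have [xa|xa] := eqVneq x.1.1 (asimple j).1.1.
  right; have dE : x - asimple j = (0, (k - m)%:~R, 0).
    apply: aff_ext => /=; first by rewrite xa subrr.
      by rewrite xk am rmorphB.
    by rewrite x2 asimple2 subr0.
  have : 0 <= k - m.
    rewrite -(ler0z R) rmorphB /= -xk -am.
    have := x0 None; case: j cj am {bj Da xa dE} => [i|] /=.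
      by rewrite subr0.
    by rewrite subr0 xk -[1]/(1%:~R) ltr0z subr_ge0 ler_int; lia.
  move: dE; case: (k - m) => // -[|l] dE _; last by exists l; rewrite dE dlMn.
  by case: (nx j); apply/eqP; rewrite -subr_eq0 dE.
left; have [j' jj' xj'] := apos_other_coord px (nx j).
apply: (@apos_coord _ j'); last first.
  by rewrite aff_coordD aff_coordN aff_coord_asimple (negPf jj') subr0.
split=> /=; first by apply: (root_acute rs).
  by exists (k - m); rewrite xk am rmorphB.
by rewrite x2 asimple2 subr0.
Qed.

Local Notation lpos := (long_pos D G).

(** * Minuscule sets of roots *)

Definition delta_sub gam : A := dl - av gam.

Definition minuscule (I : set V) s :=
  forall x, inversion s x <-> exists2 gam, I gam & x = delta_sub gam.

Definition wrootlet s mu := wact s (dl *+ 2 - av theta) = av mu.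

Definition sum_closed (I : set V) := forall gam eta,
  I gam -> Delta_pos alpha eta -> D (gam + eta) -> I (gam + eta).

Definition sum_free (I : set V) := forall gam eta, I gam -> I eta -> ~ D (gam + eta).

Lemma delta_sub_inj : injective delta_sub.
Proof. by move=> x y [] /addrI/oppr_inj. Qed.

Lemma apos_level0 (r : V) : Delta_pos alpha r -> apos (av r).
Proof. by left; exists r. Qed.

Lemma apos_delta_sub r : D r -> apos (delta_sub r).
Proof.
move=> Dr; right; exists (- r), 1%N; split=> //; first exact: rs_opp rs _ Dr.
by rewrite mulr1n addrC; congr (_ + _); apply: aff_ext; rewrite /= ?oppr0.
Qed.

Lemma aff_root_av r : D r -> aff_root (av r).
Proof. by split=> //=; exists 0. Qed.

Lemma Delta_neg_pos r : D r -> ~ Delta_pos alpha r -> Delta_pos alpha (- r).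
Proof.
move=> Dr nr; split; first exact: rs_opp rs _ Dr.
by have [r0|//] := rs_sign rs Dr; case: nr.
Qed.

Lemma Delta_posN r : Delta_pos alpha r -> Delta_pos alpha (- r) -> False.
Proof.
by move=> [Dr r0] [_ nr0]; apply: (rs_neq0 rs); rewrite -(root_leN r0 nr0).
Qed.

Section MinusculeSet.
Variables (I : set V) (s : seq J).
Hypothesis sI : minuscule I s.

Lemma minuscule_inv gam : I gam -> inversion s (delta_sub gam).
Proof. by move=> Ig; apply/sI; exists gam. Qed.

Lemma minuscule_level0 r : Delta_pos alpha r -> apos (wact s (av r)).
Proof.
move=> pr; have [//|neg] := apos_or (wact_root s (aff_root_av pr.1)).
have /sI[gam _ /(congr1 (fun x : A => x.1.2))] : inversion s (av r).
  by split=> //; apply: apos_level0.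
by rewrite /= subr0 => /esym/eqP; rewrite oner_eq0.
Qed.

(** For negative [gam], [delta - gam] is the sum of [delta], which is fixed, and the positive root
    [-gam] of level 0, whose image stays positive; so [delta - gam] could not be inverted. *)
Lemma minuscule_pos gam : I gam -> Delta_pos alpha gam.
Proof.
move=> Ig; have [pd nd] := minuscule_inv Ig.
have Dg : D gam.
  have [Dg _ _] := apos_root pd; rewrite -[gam]opprK; apply: rs_opp rs _ _.
  by rewrite /= sub0r in Dg.
apply: contrapT => ng; have pg := Delta_neg_pos Dg ng.
have pa := minuscule_level0 pg.
suff pd' : apos (wact s (delta_sub gam)) by apply: (aposNP pd' nd).
have [rd d0] := (aposP _).1 pa.
have -> : wact s (delta_sub gam) = dl + wact s (av (- gam)).
  rewrite -(wact_delta s) -wactD //; congr wact.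
  by apply: aff_ext; rewrite /= ?oppr0.
apply/(aposP); split.
  have [Dx [k kE] x2] := rd; split=> /=; rewrite ?add0r //.
  by exists (1 + k); rewrite kE rmorphD.
move=> j; rewrite aff_coordD addr_ge0 ?d0 //; case: j => [i|] /=; last exact: ler01.
by rewrite mxE add0r mul1r; apply/pos_coord/(theta_pos rs).
Qed.

Lemma minuscule_not_inv x : aff_root x -> x.1.2 != 1 -> apos x -> apos (wact s x).
Proof.
move=> rx x1 px; have [//|neg] := apos_or (wact_root s rx).
have /sI[gam _ xE] : inversion s x by [].
by move: x1; rewrite xE /= subr0 eqxx.
Qed.

(** If [gam + eta] were a root, [2 delta - (gam + eta)] would be inverted, as a sum of two inverted
    roots; but inversions have level 1. *)
Lemma minuscule_sum_free : sum_free I.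
Proof.
move=> gam eta Ig Ie Dge.
have [_ ng] := minuscule_inv Ig; have [_ ne] := minuscule_inv Ie.
pose x : A := dl *+ 2 - av (gam + eta).
have xE : x = delta_sub gam + delta_sub eta.
  rewrite /x mulr2n /delta_sub; apply: aff_ext; rewrite /= ?subr0 //.
  by rewrite addr0 !sub0r opprD.
have xE' : x = (- (gam + eta), 2, 0).
  by rewrite /x dlMn; apply: aff_ext; rewrite /= ?subr0 ?sub0r.
have rx : aff_root x.
  by rewrite xE'; split=> //=; [exact: rs_opp rs _ Dge|exists 2].
have px : apos x.
  right; exists (- (gam + eta)), 2%N; split=> //; first exact: rs_opp rs _ Dge.
  by rewrite xE' dlMn; apply: aff_ext; rewrite /= ?addr0 ?add0r.
have pax : apos (wact s x).
  apply: minuscule_not_inv => //; rewrite xE' /= -subr_eq0.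
  by rewrite -[2]/(1 + 1) addrK oner_eq0.
have [[_ _ _] ng0] := (aposP _).1 ng; have [_ ne0] := (aposP _).1 ne.
apply: (aposNP pax); apply/(aposP); split; first exact: (aff_rootN (wact_root s rx)).
move=> j; rewrite xE wactD // opprD aff_coordD addr_ge0 ?ng0 ?ne0 //.
Qed.

Lemma minuscule_sum_closed : sum_closed I.
Proof.
move=> gam eta Ig pe Dge.
have [_ ng] := minuscule_inv Ig; have pse := minuscule_level0 pe.
have pd := apos_delta_sub Dge.
suff /sI[gam' Ig' /delta_sub_inj -> //] : inversion s (delta_sub (gam + eta)).
split=> //; apply/(aposP); split; first exact: (aff_rootN (wact_root s (apos_root pd))).
have -> : delta_sub (gam + eta) = delta_sub gam - av eta.
  by apply: aff_ext; rewrite /= ?subr0 // !sub0r opprD.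
move=> j; rewrite wactD // wactN // opprD opprK aff_coordD addr_ge0 //.
  by have [_] := (aposP _).1 ng; apply.
by have [_] := (aposP _).1 pse; apply.
Qed.

End MinusculeSet.

Lemma minuscule_cons I s j gam : minuscule I s -> wact s (delta_sub gam) = asimple j ->
  Delta_pos alpha gam -> minuscule (fun r => I r \/ r = gam) (j :: s).
Proof.
move=> sI sg pg x; have pd := apos_delta_sub pg.1; split.
  move=> /(inversion_cons pd sg)[/sI[r Ir ->]|->]; first by exists r => //; left.
  by exists gam => //; right.
move=> [r [Ir|->] ->]; apply/(inversion_cons pd sg); last by right.
by left; apply/sI; exists r.
Qed.

Lemma minuscule_unique I s s' : minuscule I s -> minuscule I s' ->
  forall x, wact s x = wact s' x.
Proof.
move=> sI s'I.
have sub x : inversion s x -> inversion s' x by move=> /sI/s'I.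
have [//||s1 s1E s1' x] := inversion_chain (Q :=
  fun s1 => forall x, wact s1 x = wact s x) sub.
  move=> s1 j b _ E pb bj /s'I/sI[_]; rewrite -E bj => neg.
  by case: (aposNP (asimple_pos j) neg).
by rewrite -s1E s1'.
Qed.

(** The word for [J0] is built one root at a time. The ambient minuscule set [I] makes [J0] consist
    of positive roots no two of which sum to a root, and the word [u] leading from [s] to [s']
    shrinks at each step, which ends the recursion. *)
Lemma minuscule_exists I J0 s' : minuscule I s' -> (forall r, J0 r -> I r) ->
  sum_closed J0 -> exists s, minuscule J0 s.
Proof.
move=> s'I JI Jc; pose sub s := forall x, inversion s x ->
  exists2 gam, J0 gam & x = delta_sub gam.
have Jpos r : J0 r -> Delta_pos alpha r by move=> /JI; apply: minuscule_pos s'I _.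
suff H : forall u s, (forall x, wact u (wact s x) = wact s' x) -> sub s ->
    exists s1, minuscule J0 s1.
  by apply: (H s' [::]) => // x [px /(aposNP px)].
move=> u; have [m] := ubnP (size u); elim: m => // m IH in u *;
  rewrite ltnS => um s uE ss.
have [all_inv|] := pselect (forall r, J0 r -> inversion s (delta_sub r)).
  by exists s => x; split=> [/ss//|[r Jr ->]]; apply: all_inv.
move=> /existsNP[r0 /not_implyP[Jr0 nr0]].
pose P k := `[< exists r, [/\ J0 r, ~ inversion s (delta_sub r) & height r = k%:R] >].
have heightE r : Delta_pos alpha r -> exists k : nat, height r = k%:R.
  move=> [Dr r00]; have [k ->] := root_le_height r00; exists k.
  by rewrite height0 add0r.
have exP : exists k, P k.
  by have [k kE] := heightE _ (Jpos _ Jr0); exists k; apply/asboolP; exists r0.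
have [th thE] : exists k : nat, height theta = k%:R.
  by apply: heightE; split; [exact: rs_theta rs|exact: theta_pos rs].
have Pbound k : P k -> (k <= th)%N.
  move=> /asboolP[r [/Jpos[Dr r00] _ rE]].
  have [l] := root_le_height (rs_theta_max rs Dr r00).
  by rewrite rE thE -natrD => /eqP; rewrite eqr_nat => /eqP ->; rewrite leq_addr.
(* For [gam] of maximal height among the roots of [J0] still to be inverted,
   [wact s (delta_sub gam)] is simple, so [s] can be extended on the left. *)
case: (ex_maxnP exP Pbound) => k /asboolP[gam [Jg ng gE]] k_max.
have gmax eta : Delta_pos alpha eta -> D (gam + eta) ->
  inversion s (delta_sub (gam + eta)).
  move=> pe Dge; apply: contrapT => nge; have Jge := Jc _ _ Jg pe Dge.
  have [l lE] := heightE _ (Jpos _ Jge).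
  have := k_max l; rewrite leqNgt => /(_ _)/negP; apply.
    by apply/asboolP; exists (gam + eta).
  rewrite -(ltr_nat R) -lE heightD gE ltrDl; exact: pos_height rs _ pe.1 pe.2.
have pg := Jpos _ Jg; have pd := apos_delta_sub pg.1.
set y := wact s (delta_sub gam).
have ry : aff_root y := wact_root s (apos_root pd).
have py : apos y by have [//|ny] := apos_or ry; case: ng.
(* [delta - gam] cannot split into two roots with positive images. Both parts would be positive, by
   sum-freeness of [I], so one of them is a positive root [eta] of level 0; the other is
   [delta - (gam + eta)], inverted already by maximality of [gam]. *)
have key p q : aff_root p -> aff_root q -> apos (wact s p) -> apos (wact s q) ->
    p + q = delta_sub gam -> False.
  have neg p' q' : aff_root p' -> aff_root q' -> apos (wact s p') ->
    p' + q' = delta_sub gam -> apos p'.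
    move=> rp rq pp pq; have [//|np] := apos_or rp.
    have [|eta Je pE] := ss (- p'); first by split; rewrite // wactN // opprK.
    have qE : q' = dl *+ 2 - av (gam + eta).
      have -> : q' = delta_sub gam - p' by rewrite -pq addrC addKr.
      rewrite pE mulr2n /delta_sub; apply: aff_ext; rewrite /= ?subr0 //.
      by rewrite addr0 !sub0r opprD.
    have [Dq _ _] := rq; case: (minuscule_sum_free s'I (JI _ Jg) (JI _ Je)).
    rewrite -[gam + eta]opprK; apply: rs_opp rs _ _.
    by move: Dq; rewrite qE mulr2n /= addr0 sub0r.
  have lvl p' q' : aff_root p' -> aff_root q' -> apos p' -> apos q' ->
    apos (wact s p') ->
      p' + q' = delta_sub gam -> q'.1.2 = 0 -> False.
    move=> rp rq pp pq psp E q0; have [Dq _ q2] := rq.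
    have qv : q' = av q'.1.1 by apply: aff_ext.
    have pq1 : Delta_pos alpha q'.1.1.
      apply: contrapT => nq; have nq' := Delta_neg_pos Dq nq.
      apply: (aposNP pq); rewrite qv; have := apos_level0 nq'.
      by congr apos; apply: aff_ext; rewrite /= ?oppr0.
    have pE : p' = delta_sub (gam + q'.1.1).
      have -> : p' = delta_sub gam - q' by rewrite -E addrK.
      by rewrite qv; apply: aff_ext; rewrite /= ?subr0 // !sub0r opprD.
    have Dge : D (gam + q'.1.1).
      have [Dp _ _] := rp; rewrite -[_ + _]opprK; apply: rs_opp rs _ _.
      by move: Dp; rewrite {1}pE /= sub0r.
    by have [_] := gmax _ pq1 Dge; rewrite -pE; apply: (aposNP).
  move=> rp rq psp psq E; have pp := neg p q rp rq psp E.
  have Eq : q + p = delta_sub gam by rewrite addrC.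
  have pq := neg q p rq rp psq Eq.
  have [_ [kp kpE] _] := rp; have [_ [kq kqE] _] := rq.
  have kpq : kp + kq = 1.
    apply/eqP; rewrite -(eqr_int R) rmorphD /= -kpE -kqE.
    by have /(congr1 (fun x : A => x.1.2)) := E; rewrite /= subr0 => ->.
  have kp0 : 0 <= kp by rewrite -(ler0z R) -kpE; have [_ /(_ None)] := (aposP _).1 pp.
  have kq0 : 0 <= kq by rewrite -(ler0z R) -kqE; have [_ /(_ None)] := (aposP _).1 pq.
  have [k0|k0] : kq = 0 \/ kp = 0 by lia.
    by apply: (lvl p q) => //; rewrite kqE k0.
  by apply: (lvl q p) => //; rewrite kpE k0.
have [j yj] : exists j, y = asimple j.
  apply: contrapT => /forallNP ny; have [j [py'|[l lE]]] := apos_nonsimple py ny.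
    apply: (key (wact (rev s) (asimple j)) (wact (rev s) (y - asimple j))).
    - exact: (wact_root (rev s) (asimple_root j)).
    - exact: (wact_root (rev s) (apos_root py')).
    - by rewrite wactK_rev; apply: asimple_pos.
    - by rewrite wactK_rev.
    - by rewrite -wactD // addrC subrK (wact_revK).
  (* The remaining case [y = alpha_j + (l + 1) delta] gives [-p = gam + l delta], a positive root
     inverted by [s]. It would have to be [delta - eta] with [eta] in [J0], so that [eta = -gam]
     would be negative. *)
  set p := wact (rev s) (asimple j).
  have sp : wact s p = asimple j by apply: wactK_rev.
  have pE : p + dl *+ l.+1 = delta_sub gam.
    rewrite -[RHS](wact_revK s) -/y -[y](subrK (asimple j)) addrC lE wactD // -/p.
    by rewrite -scaler_nat wactZ // wact_delta.
  have NpE : - p = av gam + dl *+ l.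
    rewrite -[p](addrK (dl *+ l.+1)) pE opprB mulrS.
    by apply: aff_ext; rewrite dlMn /= ?addr0 ?sub0r ?add0r ?subr0 ?opprK //; ring.
  have pNp : apos (- p).
    rewrite NpE; case: l {lE pE NpE} => [|l]; first by rewrite addr0;
      apply: apos_level0.
    by right; exists gam, l.+1; split=> //; case: pg.
  have [|eta Je etaE] := ss (- p).
    by split; rewrite // wactN // opprK sp; apply: asimple_pos.
  apply: (Delta_posN pg); suff -> : - gam = eta by apply: Jpos.
  have /(congr1 (fun x : A => x.1.1)) := etaE.
  by rewrite NpE dlMn /= addr0 sub0r => ->; rewrite opprK.
have [u' u'u u'E] : exists2 u', (size u' < size u)%N & forall x,
  wact u' x = wact u (srefl j x).
  apply: (wact_exchange); rewrite -yj uE; exact: (minuscule_inv s'I (JI _ Jg)).2.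
apply: (IH u' (leq_trans u'u um) (j :: s)).
  by move=> x; rewrite u'E /= (sreflK).
by move=> x /(inversion_cons pd yj)[/ss//|->]; exists gam.
Qed.

(** * Rootlets *)

Lemma delta_sub_theta : delta_sub theta = asimple None.
Proof. by []. Qed.

Lemma theta_Delta_pos : Delta_pos alpha theta.
Proof. by split; [exact: rs_theta rs | exact: theta_pos rs]. Qed.

Lemma long_pos_theta : lpos theta.
Proof.
split; last exact: theta_pos rs.
by split; [exact: rs_theta rs | exact: theta_long rs].
Qed.

Lemma delta2_theta : dl *+ 2 - av theta = (- theta, 2, 0).
Proof. by rewrite dlMn; apply: aff_ext; rewrite /= ?subr0 ?sub0r. Qed.

Lemma minuscule_init : minuscule (fun r => r = theta) [:: None].
Proof.
have nil0 : minuscule set0 [::] by move=> x; split=> [[px /(aposNP px)]|[]].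
move=> x; have := minuscule_cons nil0 delta_sub_theta theta_Delta_pos x.
by move=> ->; split=> -[r rP ->]; exists r => //; [case: rP|right].
Qed.

Lemma srefl_theta : srefl None (av theta) = dl *+ 2 - av theta.
Proof.
have t0 := lt0r_neq0 (root_norm rs (rs_theta rs)).
rewrite sreflE !aff_form_root /= ?subr0 // sub0r formNr formNl formNr opprK.
set c := (X in X *: _); have -> : c = - 2 by rewrite /c; field.
rewrite scaleNr opprK dlMn; apply: aff_ext; rewrite /= ?subr0 ?scaler0 ?addr0 //.
  by rewrite !sub0r scalerN scaler_nat mulr2n opprD addrA subrr add0r.
by rewrite add0r -[LHS]/(2 * 1) mulr1.
Qed.

Lemma wrootlet_init : wrootlet [:: None] theta.
Proof. by rewrite /wrootlet /= -srefl_theta (sreflK). Qed.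

Lemma srefl_some_level i x : (srefl (Some i) x).1.2 = x.1.2.
Proof. by rewrite sreflE /= scaler0 subr0. Qed.

Lemma srefl_av i r : D r -> exists a : int,
  [/\ 2 * B (sr i) r = a%:~R * B (sr i) (sr i),
    srefl (Some i) (av r) = av (r - sr i *~ a)
    & D (r - sr i *~ a)].
Proof.
move=> Dr; have [a [aE rE [Da _ _]]] := srefl_int (Some i) (aff_root_av Dr).
have E : srefl (Some i) (av r) = av (r - sr i *~ a).
  by rewrite rE -!scaler_int; apply: aff_ext; rewrite /= ?scaler0 ?subr0.
exists a; split=> //; last by rewrite E in Da.
by move: aE; rewrite !aff_form_root //= (root_formC rs).
Qed.

Lemma form_delta_sub gam : aB (delta_sub gam) (dl *+ 2 - av theta) = B gam theta.
Proof.
by rewrite dlMn aff_form_root /= ?subr0 // !sub0r formNl formNr opprK.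
Qed.

(* [(delta - gam, 2 delta - theta) = (gam, theta)], so the rootlet only changes when
   [gam] is not orthogonal to [theta], and it then goes down. *)
Lemma wrootlet_step s j gam nu : Delta_pos alpha gam ->
  wact s (delta_sub gam) = asimple j ->
  wrootlet s nu -> lpos nu ->
    exists nu', [/\ wrootlet (j :: s) nu', lpos nu', nu' <=r nu,
    B gam theta = 0 -> nu' = nu & 0 < B gam theta -> j <> None].
Proof.
move=> pg sg snu lnu; have [Dg g0] := pg.
have jnu : aB (asimple j) (av nu) = B gam theta.
  by rewrite -form_delta_sub -(wact_form s (delta_sub gam)) sg (snu : wact s _ = _).
have bg := theta_dominant rs Dg g0.
case: j => [i|] in sg jnu *; last first.
  (* Here [(gam, theta) = (alpha_0, nu) = -(theta, nu)], nonnegative on the left and nonpositive on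
     the right by dominance of [theta]. *)
  have E : B gam theta = 0.
    apply/eqP; rewrite eq_le bg andbT -jnu aff_form_root /= ?subr0 //.
    rewrite sub0r formNl oppr_le0 (root_formC rs);
      exact: (theta_dominant rs lnu.1.1 lnu.2).
  exists nu; rewrite E ltxx; split=> //; last exact: root_le_refl.
  rewrite /wrootlet /= (snu : wact s _ = _) sreflE aff_formC jnu E mulr0 mul0r scale0r subr0 //.
have [a [aE rE Da]] := srefl_av i lnu.1.1.
have ni := root_norm rs (rs_simple rs i).
have jE : B (sr i) nu = B gam theta by rewrite -jnu aff_form_root.
have a0 : 0 <= a by rewrite -(ler0z R) -(pmulr_lge0 _ ni) -aE jE mulr_ge0.
(* Otherwise [s] would send [delta - gam], of level 1, and [2 delta - theta], of level 2, to the
   same root. *)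
have nui : nu <> sr i.
  move=> E; have : dl *+ 2 - av theta = delta_sub gam.
    by rewrite -(wact_revK s (delta_sub gam)) sg -(wact_revK s (_ - _)) (snu : wact s _ = _) E.
  rewrite dlMn => /(congr1 (fun x : A => x.1.2)) /=; rewrite !subr0 => /eqP.
  by rewrite -subr_eq0 -[2%:R]/(1 + 1) addrK oner_eq0.
exists (nu - sr i *~ a); split=> //.
- by rewrite /wrootlet /= (snu : wact s _ = _) rE.
- exact: (long_pos_refl rs lnu aE nui Da).
- apply/root_leP => l; case: a a0 {aE rE Da} => // a _.
  exists ((l == i) * a)%N; rewrite -scaler_int !mxE eqxx /=.
  by rewrite natrM -pmulrn mulrC subrK.
- move=> E; have /eqP : a%:~R * B (sr i) (sr i) = 0 by rewrite -aE jE E mulr0.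
  by rewrite mulf_eq0 intr_eq0 (negPf (lt0r_neq0 ni)) orbF => /eqP ->;
    rewrite mulr0z subr0.
Qed.

(** The first root inverted on the way from the identity is an affine simple root. It has level 1,
    hence is [alpha_0 = delta - theta]; without [theta] in [I] the chain never leaves the
    identity. *)
Lemma minuscule_theta I s r : minuscule I s -> I r -> I theta.
Proof.
move=> sI Ir; apply: contrapT => nt.
have sub0 x : inversion [::] x -> inversion s x by move=> [px /(aposNP px)].
have [//||s1 s1E sE] := inversion_chain (Q := fun s1 => forall x, wact s1 x = x) sub0.
  move=> s1 j b sub s1E pb; rewrite s1E => bj /sI[gam Ig bE].
  case: nt; suff -> : theta = gam by [].
  apply: delta_sub_inj; rewrite -bE bj; case: j bj => [i|//] bj.
  have := congr1 (fun x : A => x.1.2) bE; rewrite bj /= subr0 => /eqP.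
  by rewrite eq_sym oner_eq0.
have [pr nr] := minuscule_inv sI Ir.
by apply: (aposNP pr); rewrite -sE s1E in nr.
Qed.

Lemma inversion_init I s : minuscule I s -> I theta ->
  forall x, inversion [:: None] x -> inversion s x.
Proof. by move=> sI It x /minuscule_init[r -> ->]; apply: (minuscule_inv sI It). Qed.

Lemma wrootlet_exists I s : minuscule I s -> I theta ->
  exists2 nu, wrootlet s nu & lpos nu.
Proof.
move=> sI It.
have [||s1 [nu s1nu lnu] s1E] := inversion_chain
    (Q := fun s1 => exists2 nu, wrootlet s1 nu & lpos nu) (inversion_init sI It).
- by exists theta; [exact: wrootlet_init|exact: long_pos_theta].
- move=> s1 j b _ [nu s1nu lnu] pb bj /sI[gam Ig bE].
  have pg := minuscule_pos sI Ig; rewrite bE in bj.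
  by have [nu' [? ? _ _ _]] := wrootlet_step pg bj s1nu lnu; exists nu'.
by exists nu; rewrite /wrootlet -?s1E.
Qed.

Lemma wrootlet_le I J0 s s' nu : minuscule J0 s -> minuscule I s' ->
  (forall r, J0 r -> I r) ->
  wrootlet s nu -> lpos nu -> exists2 mu, wrootlet s' mu & mu <=r nu.
Proof.
move=> sJ sI JI snu lnu.
have sub x : inversion s x -> inversion s' x.
  by move=> /sJ[r Jr ->]; apply: (minuscule_inv sI (JI _ Jr)).
have [||s1 [mu [s1mu lmu munu]] s1E] := inversion_chain
    (Q := fun s1 => exists mu, [/\ wrootlet s1 mu, lpos mu & mu <=r nu]) sub.
- by exists nu; split=> //; apply: root_le_refl.
- move=> s1 j b _ [mu [s1mu lmu munu]] pb bj /sI[gam Ig bE].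
  have pg := minuscule_pos sI Ig; rewrite bE in bj.
  have [mu' [? ? mumu' _ _]] := wrootlet_step pg bj s1mu lmu; exists mu'; split=> //.
  exact: root_le_trans mumu' munu.
by exists mu; rewrite /wrootlet -?s1E.
Qed.

Lemma wrootlet_eq I J0 s s' nu : minuscule J0 s -> minuscule I s' ->
  (forall r, J0 r -> I r) ->
  (forall r, I r -> 0 < B r theta -> J0 r) -> wrootlet s nu -> lpos nu ->
    wrootlet s' nu.
Proof.
move=> sJ sI JI IJ snu lnu.
have sub x : inversion s x -> inversion s' x.
  by move=> /sJ[r Jr ->]; apply: (minuscule_inv sI (JI _ Jr)).
have [||s1 [s1nu _] s1E] := inversion_chain
    (Q := fun s1 => wrootlet s1 nu /\ forall x, inversion s x -> inversion s1 x) sub.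
- by split.
- move=> s1 j b _ [s1nu ss1] pb bj /sI[gam Ig bE].
  have pg := minuscule_pos sI Ig; have [Dg g0] := pg; rewrite bE in bj.
  have pd := apos_delta_sub Dg.
  have [nu' [s1nu' _ _ nuE _]] := wrootlet_step pg bj s1nu lnu.
  split; last by move=> x /ss1 sx; apply/(inversion_cons pd bj); left.
  rewrite -nuE //; apply/eqP; rewrite eq_le (theta_dominant rs Dg g0) andbT leNgt.
  apply/negP => /(IJ _ Ig)/(minuscule_inv sJ)/ss1[_].
  by rewrite bj; apply: (aposNP (asimple_pos j)).
by rewrite /wrootlet -s1E.
Qed.

Lemma wact_some_level v x : all isSome v -> (wact v x).1.2 = x.1.2.
Proof.
elim: v x => // -[i|//] v IH x vs.
exact: etrans (srefl_some_level i (wact v x)) (IH x vs).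
Qed.

(** By the last clause of [wrootlet_step], adding a root not orthogonal to [theta] never uses the
    letter [s_0], so only the initial letter is affine. *)
Lemma minuscule_decomposition K s : minuscule K s -> K theta ->
  (forall r, K r -> 0 < B r theta) ->
  exists2 v, all isSome v & forall x, wact (v ++ [:: None]) x = wact s x.
Proof.
move=> sK Kt KH.
have [||s1 [_ [_ _ [v vs s1v]]] s1E] := inversion_chain
    (Q := fun s1 => exists nu, [/\ wrootlet s1 nu, lpos nu &
       exists2 v, all isSome v & s1 = v ++ [:: None]]) (inversion_init sK Kt).
- exists theta; split; [exact: wrootlet_init|exact: long_pos_theta|by exists [::]].
- move=> s1 j b _ [nu [s1nu lnu [v vs s1v]]] pb bj /sK[gam Kg bE].
  have pg := minuscule_pos sK Kg; rewrite bE in bj.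
  have [nu' [s1nu' lnu' _ _ jN]] := wrootlet_step pg bj s1nu lnu; exists nu';
    split=> //.
  case: j => [i|] in bj jN s1nu' *; first by exists (Some i :: v); rewrite //= s1v.
  by case: jN => //; apply: KH.
by exists v; rewrite -?s1v.
Qed.

(** A reflection of the rootlet given by [down_step] is realized by adding the root [gam] with
    [s^-1 alpha_i = delta - gam]; it satisfies [(gam, theta) = (alpha_i, nu) > 0]. The work is to
    show that [s^-1 alpha_i] has this form. *)
Lemma wrootlet_down J0 s nu mu : minuscule J0 s -> wrootlet s nu -> lpos nu ->
  lpos mu -> mu <=r nu ->
  exists I s', [/\ minuscule I s', wrootlet s' mu, forall r, J0 r -> I r
    & forall r, I r -> J0 r \/ 0 < B r theta].
Proof.
move=> sJ snu lnu lmu munu; have [k] := root_le_height munu.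
elim/ltn_ind: k => k IH in J0 s nu sJ snu lnu munu *; move=> hE.
have [mn|nmu] := pselect (mu = nu); first by exists J0, s; rewrite mn; split=> //; left.
have [i [a [a0 aE nui lnu' munu']]] := down_step rs lmu lnu munu nmu.
(* The minuscule condition forces [s^-1 alpha_i] to have level 1. *)
set b := wact (rev s) (asimple (Some i));
have sb : wact s b = asimple (Some i) by apply: wactK_rev.
have rb : aff_root b := wact_root _ (asimple_root _); have [Db [m mE] b2] := rb.
have ni := root_norm rs (rs_simple rs i).
have bi : 0 < B (sr i) nu.
  by rewrite -(pmulr_rgt0 _ (ltr0n R 2)) aE mulr_gt0 // ltr0z.
have bt : - B b.1.1 theta = B (sr i) nu.
  have := wact_form s b (dl *+ 2 - av theta); rewrite sb (snu : wact s _ = _).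
  by rewrite delta2_theta !aff_form_root //= formNr.
have nb : ~ Delta_pos alpha b.1.1.
  by move=> [_ b0]; have := theta_dominant rs Db b0; lra.
have pb := Delta_neg_pos Db nb.
have Nsb : wact s (- b) = - asimple (Some i) by rewrite wactN sb.
(* At level at most 0, [-b] would be positive and inverted, so [-b = delta - gam] with [gam] equal
   to the finite part of [b], which is negative. *)
have m1 : 1 <= m.
  rewrite leNgt -[1]add0r ltzD1; apply/negP => m0.
  have pNb : apos (- b).
    have [pb'|//] := apos_or rb; case: nb; split=> //.
    have [_ bc] := (aposP _).1 pb'; have := bc None; rewrite /= mE ler0z => m0'.
    have m00 : m = 0 by lia.
    have [//|neg] := rs_sign rs Db; case: (rs_neq0 rs).
    suff <- : b.1.1 = 0 by [].
    apply/rowP => l; have := bc (Some l); have := pos_coord l neg.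
    by rewrite /= mE m00 mul0r addr0 !mxE; lra.
  have /sJ[gam Jg bE] : inversion s (- b).
    by split; rewrite // Nsb opprK; apply: asimple_pos.
  apply: nb; suff -> : b.1.1 = gam by apply: (minuscule_pos sJ Jg).
  have /(congr1 (fun x : A => x.1.1)) := bE.
  by rewrite /= sub0r => /oppr_inj.
(* For [m >= 2], write [b] as [2 delta - theta] plus [(m - 2) delta] plus [b.1.1 + theta]. If
   nonzero, the last term is a positive root of level 0, so its image [alpha_i - nu - (m - 2) delta]
   is positive; this forces [m = 2], and then [alpha_i - nu] has height at most 0. If it is zero,
   [nu = alpha_i]. *)
have m2 : m = 1.
  apply: contrapT => m1'; have {m1 m1'}m2 : 2 <= m by lia.
  have bN : b = (dl *+ 2 - av theta) + (m - 2)%:~R *: dl + av (b.1.1 + theta).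
    rewrite dlMn; apply: aff_ext; rewrite /= ?scaler0 ?addr0 ?subr0 //.
      by rewrite sub0r addrC addrK.
    by rewrite mE rmorphB -[_ *: _]/(_ * _) mulr1 addrC subrK.
  have := sb; rewrite bN wactD wactD wactZ wact_delta (snu : wact s _ = _).
  set z := wact s _ => zE.
  have z11 : z.1.1 = sr i - nu.
    have /(congr1 (fun x : A => x.1.1)) := zE.
    by rewrite /= scaler0 addr0 => <-; rewrite addrC addKr.
  have z12 : z.1.2 = - (m - 2)%:~R.
    have /(congr1 (fun x : A => x.1.2)) := zE.
    by rewrite /= -[_ *: _]/(_ * _) mulr1 add0r => /eqP; rewrite addr_eq0 => /eqP ->;
      rewrite opprK.
  have [t0|t0] := eqVneq (b.1.1 + theta) 0.
    apply: nui; apply/esym/eqP; rewrite -subr_eq0 -z11 /z t0.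
    by have -> : wact s (av 0) = 0 by rewrite -[av 0]/(0 : A) -(scale0r 0) wactZ !scale0r.
  have Dt : D (b.1.1 + theta).
    by apply: (root_obtuse rs) => //; [exact: rs_theta rs|lra].
  have t_pos : Delta_pos alpha (b.1.1 + theta).
    split=> //; have := rs_theta_max rs pb.1 pb.2.
    move=> /root_leP bt'; apply/root_leP => l; have [c cE] := bt' l; exists c.
    by rewrite !mxE cE mxE; ring.
  have [[Dz _ _] zc] := (aposP _).1 (minuscule_level0 sJ t_pos).
  rewrite -/z in Dz zc.
  have m2' : m = 2.
    have := zc None; rewrite /= z12 oppr_ge0 lerz0; lia.
  have z0 : root_le 0 (sr i - nu).
    have [//|neg] := rs_sign rs Dz; first by rewrite -z11.
    case: (rs_neq0 rs); suff <- : z.1.1 = 0 by [].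
    apply/rowP => l; have := zc (Some l); have := pos_coord l neg.
    by rewrite /= z12 m2' subrr oppr0 mul0r addr0 !mxE; lra.
  have := pos_height rs _ z0; rewrite -z11 => /(_ Dz).
  rewrite z11 heightD heightN height_simple.
  have [c] := root_le_height lnu.2; rewrite height0 add0r.
  move=> cE; have := pos_height rs lnu.1.1 lnu.2; rewrite cE ltr0n subr_gt0.
  by rewrite -[1]/(1%:R) ltr_nat; case: c {cE}.
have bE : b = delta_sub (- b.1.1).
  by apply: aff_ext; rewrite /= ?subr0 ?sub0r ?opprK ?mE ?m2 ?b2.
have sgam : wact s (delta_sub (- b.1.1)) = asimple (Some i) by rewrite -bE.
have [a' [aE' rE _]] := srefl_av i lnu.1.1.
have aa' : a' = a.
  apply/eqP; rewrite -(eqr_int R); apply/eqP/(mulIf (lt0r_neq0 ni)).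
  by rewrite -aE' aE.
have [k' k'E] := root_le_height munu'.
have kk' : (k' < k)%N.
  have := k'E; rewrite heightD heightN hE -scaler_int heightZ height_simple mulr1.
  rewrite -addrA => /addrI E; have : (k : int)%:~R = (k' : int)%:~R + a%:~R :> R.
    by rewrite -!pmulrn; lra.
  by rewrite -rmorphD /= => /eqP; rewrite eqr_int => /eqP; lia.
have snu' : wrootlet (Some i :: s) (nu - sr i *~ a).
  by rewrite /wrootlet /= (snu : wact s _ = _) rE aa'.
have [I [s' [sI s'mu JI IJ]]] :=
  IH k' kk' _ _ _ (minuscule_cons sJ sgam pb) snu' lnu' munu' k'E.
exists I, s'; split=> //; first by move=> r Jr; apply: JI; left.
move=> r /IJ[[Jr|->]|]; [by left|right|by right].
by rewrite formNl; lra.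
Qed.

(** For a step of [up_step], [v^-1 alpha_i] has level 0 because [v] is finite, and [s_0] moves it to
    level [2 (alpha_i, mu) / (theta, theta) < 0]. So [-b] is inverted by [v s_0], and prefixing
    [s_i] removes it. *)
Lemma wrootlet_up v K mu kap : all isSome v -> minuscule K (v ++ [:: None]) ->
  wrootlet (v ++ [:: None]) mu -> lpos mu -> lpos kap -> mu <=r kap ->
  exists v' K', [/\ all isSome v', minuscule K' (v' ++ [:: None]),
    wrootlet (v' ++ [:: None]) kap & forall r, K' r -> K r].
Proof.
move=> vs sK smu lmu lkap mukap; have [k] := root_le_height mukap.
elim/ltn_ind: k => k IH in v vs K mu sK smu lmu mukap *; move=> hE.
have [mk|nmu] := pselect (mu = kap); first by exists v, K; rewrite -mk.
have [i [a [a0 aE lmu' mukap']]] := up_step rs lmu lkap mukap nmu.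
set s := v ++ [:: None] in sK smu.
set b := wact (rev s) (asimple (Some i));
have sb : wact s b = asimple (Some i) by apply: wactK_rev.
have rb : aff_root b := wact_root _ (asimple_root _); have [Db [m mE] b2] := rb.
have ni := root_norm rs (rs_simple rs i).
have bi : B (sr i) mu < 0.
  by rewrite -(pmulr_rlt0 _ (ltr0n R 2)) aE nmulr_rlt0 // ltrz0.
pose y := wact (rev v) (asimple (Some i)).
have ry : aff_root y := wact_root _ (asimple_root _).
have bE : b = srefl None y by rewrite /b /s rev_cat wact_cat.
have y1 : y.1.2 = 0 by rewrite wact_some_level // all_rev.
have yt : B y.1.1 theta = B (sr i) mu.
  have := srefl_form None y (av theta); rewrite -bE srefl_theta.
  have := wact_form s b (dl *+ 2 - av theta); rewrite sb (smu : wact s _ = _).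
  by move=> <-; have [_ _ y2] := ry; rewrite !aff_form_root //= => ->.
have nt := root_norm rs (rs_theta rs).
have b1 : b.1.2 < 0.
  have [_ _ y2] := ry.
  rewrite bE sreflE !aff_form_root /= ?subr0 // !sub0r !formNr formNl opprK y1 sub0r.
  by rewrite -[_ *: _]/(_ * _) mulr1 yt oppr_lt0 divr_gt0 //; lra.
have pNb : apos (- b).
  have [pb|//] := apos_or rb.
  by have [_ /(_ None)] := (aposP _).1 pb; rewrite /= leNgt b1.
(* [inversion_cons] is applied in reverse: [s] acts as [s_i (s_i s)], and [s_i s] sends [-b] to
   [alpha_i], so [s] has the inversions of [s_i s] together with [-b]. *)
have s1b : wact (Some i :: s) (- b) = asimple (Some i).
  by rewrite /= wactN sb -scaleN1r sreflZ (srefl_asimple) scaleN1r opprK.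
have s1E x : wact (Some i :: Some i :: s) x = wact s x by rewrite /= (sreflK).
have inversion_s x : inversion (Some i :: Some i :: s) x <->
  inversion s x by rewrite /inversion s1E.
have not_inv : ~ inversion (Some i :: s) (- b).
  by move=> [_]; rewrite s1b; apply: (aposNP (asimple_pos _)).
have sK' : minuscule (fun r => K r /\ delta_sub r <> - b) (Some i :: s).
  move=> x; split=> [ix|[r [Kr rb'] xE]].
    have /inversion_s/sK[r Kr xE] : inversion (Some i :: Some i :: s) x.
      by apply/(inversion_cons pNb s1b); left.
    by exists r => //; split=> // rb'; case: not_inv; rewrite -rb' -xE.
  have /inversion_s/(inversion_cons pNb s1b)[//|xb] : inversion s x by apply/sK;
    exists r.
  by case: rb'; rewrite -xE.
have [a' [aE' rE _]] := srefl_av i lmu.1.1.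
have aa' : a' = a.
  by apply/eqP; rewrite -(eqr_int R); apply/eqP/(mulIf (lt0r_neq0 ni)); rewrite -aE' aE.
have smu' : wrootlet (Some i :: s) (mu - sr i *~ a).
  by rewrite /wrootlet /= (smu : wact s _ = _) rE aa'.
have [k' k'E] := root_le_height mukap'.
have kk' : (k' < k)%N.
  move: k'E; rewrite hE heightD heightN -scaler_int heightZ height_simple mulr1.
  rewrite -addrA => /addrI E; have : (k' : int)%:~R = (k : int)%:~R + a%:~R :> R.
    by rewrite -!pmulrn; lra.
  by rewrite -rmorphD /= => /eqP; rewrite eqr_int => /eqP; lia.
have [v' [K' [v's sK'' s'kap KK']]] :=
  IH k' kk' (Some i :: v) vs _ _ sK' smu' lmu' mukap' k'E.
by exists v', K'; split=> // r /KK'[].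
Qed.

(* [z = v^-1 v'] fixes [theta] and preserves level 0, so [z] negates no affine
   simple root: [z alpha_i < 0] would put a root of level 0 in an inversion set. *)
Lemma wrootlet_some_unique v v' K K' kap : all isSome v -> all isSome v' ->
  minuscule K (v ++ [:: None]) -> minuscule K' (v' ++ [:: None]) ->
  wrootlet (v ++ [:: None]) kap -> wrootlet (v' ++ [:: None]) kap ->
  forall r, K r <-> K' r.
Proof.
move=> vs v's sK sK' vk v'k.
have rtE u : wrootlet (u ++ [:: None]) kap -> wact u (av theta) = av kap.
  by rewrite /wrootlet wact_cat /= -srefl_theta (sreflK).
have z_id : forall x, wact (rev v ++ v') x = x.
  apply: (wact_eq_id) => j; set z := rev v ++ v'.
  have zs : all isSome z by rewrite all_cat all_rev vs v's.
  have zt : wact z (av theta) = av theta.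
    by rewrite wact_cat (rtE _ v'k) -(rtE _ vk) (wact_revK).
  have rj := wact_root z (asimple_root j).
  have [//|neg] := apos_or rj; exfalso.
  case: j => [i|] in rj neg *; last first.
    apply: (aposNP (asimple_pos None)); move: neg.
    by rewrite wactD wactN zt wact_delta.
  set y := wact z _ in rj neg; have [Dy _ y2] := rj.
  have y1 : y.1.2 = 0 by rewrite wact_some_level.
  have yE : y = av y.1.1 by apply: aff_ext.
  have pNy : Delta_pos alpha (- y.1.1).
    apply: contrapT => npos; have := Delta_neg_pos (rs_opp rs Dy) npos.
    rewrite opprK => /apos_level0; rewrite -yE => py; exact: (aposNP py neg).
  have si : Delta_pos alpha (sr i) by split;
    [exact: rs_simple rs i|exact: simple_pos rs i].
  have y0 : B y.1.1 theta = 0.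
    have yt : B y.1.1 theta = B (sr i) theta.
      by have := wact_form z (asimple (Some i)) (av theta); rewrite zt !aff_form_root.
    have := theta_dominant rs pNy.1 pNy.2; rewrite formNl.
    by have := theta_dominant rs si.1 si.2; rewrite -yt; lra.
  (* Both [-y] and [alpha_i] are orthogonal to [theta], hence fixed by [s_0], so [v (-y)] and
     [v' alpha_i] are positive; but [v y = v' alpha_i]. *)
  have fixN (r : V) : B r theta = 0 -> srefl None (av r) = av r.
    move=> r0; rewrite sreflE aff_form_root /= ?subr0 // sub0r formNr r0 oppr0.
    by rewrite mulr0 mul0r scale0r subr0.
  have vy : wact v y = wact v' (av (sr i)) by rewrite /y wact_cat wactK_rev.
  have p1 : apos (wact v' (av (sr i))).
    have := minuscule_level0 sK' si; rewrite wact_cat /= fixN //.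
    by rewrite -y0; have := wact_form z (asimple (Some i)) (av theta);
      rewrite zt !aff_form_root.
  have := minuscule_level0 sK pNy; rewrite wact_cat /= fixN ?formNl ?y0 ?oppr0 //.
  have -> : av (- y.1.1) = - y by rewrite yE; apply: aff_ext; rewrite /= ?oppr0.
  by rewrite wactN vy; apply: (aposNP p1).
have vv' x : wact (v ++ [:: None]) x = wact (v' ++ [:: None]) x.
  by rewrite !wact_cat -[in LHS](z_id (wact [:: None] x)) wact_cat wactK_rev.
have invE x : inversion (v ++ [:: None]) x <->
  inversion (v' ++ [:: None]) x by rewrite /inversion vv'.
move=> r; split=> [Kr|Kr].
  have /invE/sK'[r' Kr' /delta_sub_inj -> //] := minuscule_inv sK Kr.
have /invE/sK[r' Kr' /delta_sub_inj -> //] := minuscule_inv sK' Kr.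
Qed.

(** * Rootlets of intersections *)

Definition set_rootlet (I : set V) mu := exists2 s, minuscule I s & wrootlet s mu.

Lemma minuscule_eq_act I s s' : (forall x, wact s x = wact s' x) -> minuscule I s ->
  minuscule I s'.
Proof. by move=> ss' sI x; rewrite -sI /inversion ss'. Qed.

Lemma wrootlet_theta I s mu : minuscule I s -> wrootlet s mu -> I theta.
Proof.
move=> sI smu; have [[r Ir]|/forallNP nI] := pselect (exists r, I r).
  exact: (minuscule_theta sI Ir).
have nil0 : minuscule I [::].
  by move=> x; split=> [[px /(aposNP px)]|[r /nI]].
have /= E := minuscule_unique nil0 sI (dl *+ 2 - av theta).
move: smu; rewrite /wrootlet -E delta2_theta => /(congr1 (fun x : A => x.1.2)) /= /eqP.
by rewrite pnatr_eq0.
Qed.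

Lemma av_inj : injective (@affV_of R n).
Proof. by move=> x y []. Qed.

(* Intersecting with the roots not orthogonal to [theta] keeps the rootlet and yields
   a word [v s_0] with [v] in the finite Weyl group. *)
Lemma wrootlet_heisenberg I s mu : minuscule I s -> wrootlet s mu -> lpos mu ->
  exists v, [/\ all isSome v, minuscule (fun r => I r /\ 0 < B r theta) (v ++ [:: None])
    & wrootlet (v ++ [:: None]) mu].
Proof.
move=> sI smu lmu; have It := wrootlet_theta sI smu.
pose J0 r := I r /\ 0 < B r theta.
have J0t : J0 theta by split=> //; apply: (root_norm rs (rs_theta rs)).
have J0c : sum_closed J0.
  move=> gam eta [Ig g0] pe Dge; split; first exact: (minuscule_sum_closed sI).
  by rewrite formDl; have := theta_dominant rs pe.1 pe.2; lra.
have [s0 s0J] := minuscule_exists sI (fun r (h : J0 r) => h.1) J0c.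
have [nu s0nu lnu] := wrootlet_exists s0J J0t.
have snu := wrootlet_eq s0J sI (fun r (h : J0 r) => h.1) (fun r h1 h2 =>
  conj h1 h2) s0nu lnu.
have numu : nu = mu by apply: av_inj; rewrite -snu.
have [v vs vE] := minuscule_decomposition s0J J0t (fun r (h : J0 r) => h.2).
exists v; split=> //; first by apply: minuscule_eq_act s0J => x; rewrite vE.
by rewrite /wrootlet vE -numu.
Qed.

Lemma wrootlet_above I mu kap : set_rootlet I mu -> lpos mu -> lpos kap -> mu <=r kap ->
  exists v K, [/\ all isSome v, minuscule K (v ++ [:: None]),
    wrootlet (v ++ [:: None]) kap
    & forall r, K r -> I r].
Proof.
move=> [s sI smu] lmu lkap mukap;
  have [v [vs vI vmu]] := wrootlet_heisenberg sI smu lmu.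
have [v' [K [v's v'K v'kap KI]]] := wrootlet_up vs vI vmu lmu lkap mukap.
by exists v', K; split=> // r /KI[].
Qed.

Lemma set_rootlet_meet I I' mu mu' : set_rootlet I mu -> set_rootlet I' mu' ->
  lpos mu -> lpos mu' ->
  exists nu, [/\ set_rootlet (fun r => I r /\ I' r) nu, lpos nu, mu <=r nu, mu' <=r nu
    & forall kap, lpos kap -> mu <=r kap -> mu' <=r kap -> nu <=r kap].
Proof.
move=> mI mI' lmu lmu'; have [s sI smu] := mI; have [s' s'I' s'mu'] := mI'.
pose J0 r := I r /\ I' r.
have J0c : sum_closed J0.
  move=> gam eta [Ig I'g] pe Dge; split; first exact: (minuscule_sum_closed sI).
  exact: (minuscule_sum_closed s'I').
have JI r : J0 r -> I r by case.
have JI' r : J0 r -> I' r by case.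
have [s0 s0J] := minuscule_exists sI JI J0c.
have J0t : J0 theta by split;
  [exact: wrootlet_theta sI smu|exact: wrootlet_theta s'I' s'mu'].
have [nu s0nu lnu] := wrootlet_exists s0J J0t.
exists nu; split=> //; first by exists s0.
- have [m sm] := wrootlet_le s0J sI JI s0nu lnu.
  by suff -> : mu = m by []; apply: av_inj; rewrite -smu -sm.
- have [m sm] := wrootlet_le s0J s'I' JI' s0nu lnu.
  by suff -> : mu' = m by []; apply: av_inj; rewrite -s'mu' -sm.
move=> kap lkap mukap mu'kap.
have [v [K [vs vK vkap KI]]] := wrootlet_above mI lmu lkap mukap.
have [v' [K' [v's v'K' v'kap K'I']]] := wrootlet_above mI' lmu' lkap mu'kap.
have KK' := wrootlet_some_unique vs v's vK v'K' vkap v'kap.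
have KJ r : K r -> J0 r by move=> Kr; split; [apply: KI|apply/K'I'/KK'].
have [m s0m mkap] := wrootlet_le vK s0J KJ vkap lkap.
by suff -> : nu = m by []; apply: av_inj; rewrite -s0nu -s0m.
Qed.

Lemma set_rootlet_split J0 nu mu mu' : set_rootlet J0 nu -> lpos nu -> lpos mu ->
  lpos mu' ->
  mu <=r nu -> mu' <=r nu ->
  (forall kap, lpos kap -> mu <=r kap -> mu' <=r kap -> nu <=r kap) ->
  exists I I', [/\ set_rootlet I mu, set_rootlet I' mu' & forall r, J0 r <->
    I r /\ I' r].
Proof.
move=> [s sJ snu] lnu lmu lmu' munu mu'nu nu_min.
have [I [sa [aI amu JI IJ]]] := wrootlet_down sJ snu lnu lmu munu.
have [I' [sb [bI' bmu' JI' I'J]]] := wrootlet_down sJ snu lnu lmu' mu'nu.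
have mI : set_rootlet I mu by exists sa.
have mI' : set_rootlet I' mu' by exists sb.
exists I, I'; split=> // r; split=> [Jr|[Ir I'r]]; first by split;
  [apply: JI|apply: JI'].
have [nu' [[s0 s0J s0nu'] lnu' munu' mu'nu' nu'_min]] :=
  set_rootlet_meet mI mI' lmu lmu'.
have nuE : nu' = nu by apply: root_le_anti; [apply: nu'_min|apply: nu_min].
rewrite nuE in s0nu'.
have [v [vs vJ vnu]] := wrootlet_heisenberg sJ snu lnu.
have [v' [v's v'J v'nu]] := wrootlet_heisenberg s0J s0nu' lnu.
have [//|rt0] := IJ r Ir.
by have [] := (wrootlet_some_unique vs v's vJ v'J vnu v'nu r).2 (conj (conj Ir I'r) rt0).
Qed.

Lemma set_rootlet_nonempty mu : lpos mu -> exists I, set_rootlet I mu.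
Proof.
move=> lmu; have mt := rs_theta_max rs lmu.1.1 lmu.2.
have [I [s [sI smu _ _]]] :=
  wrootlet_down minuscule_init wrootlet_init long_pos_theta lmu mt.
by exists I, s.
Qed.

End Affine.

(** * Abelian ideals *)

Section AbelianIdeals.
Variables (R : realType) (g : lieAlgType R[i]) (t : {vspace g}) (n : nat).
Variables (alpha : n.-tuple (dual R[i] t)) (G : 'M[R]_n) (theta : 'rV[R]_n).
Hypotheses (g_simple : lie_simple g) (t_cartan : cartan_subalgebra t).
Hypotheses (alpha_base : root_base alpha) (G_inner : invariant_inner_product alpha G).
Hypothesis theta_highest : highest_root alpha theta.
Variables (e : (dim g).-tuple g) (lam : 'I_(dim g) -> dual R[i] t).
Hypothesis e_basis : basis_of fullv e.
Hypothesis e_weight : forall i, weight_space (lam i) (tnth e i).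
Local Notation D := (Delta alpha).
Local Notation V := 'rV[R]_n.
Local Notation wt := (weight_of alpha).
Local Notation kn rx :=
  (killing_nondeg_of_base e_basis e_weight g_simple alpha_base rx).
Implicit Types (r : V) (I : set V) (a b : {vspace g}) (x y z : g) (i j : 'I_(dim g)).

Lemma root_system : based_root_system D G theta.
Proof.
have [GT Gpos _] := G_inner; have [[Dt t0] tmax] := theta_highest.
split=> //.
- exact: Delta_sign alpha_base.
- exact: Delta_simple alpha_base.
- exact: Delta0.
- exact: (DeltaN alpha_base g_simple e_basis e_weight).
- exact: (Delta_double alpha_base g_simple t_cartan e_basis e_weight).
- exact: (Delta_reflection alpha_base g_simple t_cartan e_basis e_weight G_inner).
- by move=> x Dx x0; apply: tmax.
Qed.

Let rs := root_system.

Lemma lam_root_inj i j : is_root (lam i) -> lam i = lam j -> i = j.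
Proof.
move=> ri ij; have ej : weight_space (lam i) (tnth e j) by rewrite ij.
have [c cE] := root_space_line e_basis e_weight t_cartan (kn ri) ri
  (e_weight i) (tnth_neq0 e_basis i) ej.
apply: contrapT => ne; have := coord_tnth e_basis j j.
rewrite {1}cE linearZ /= coord_tnth // eqxx; have [//|_] := eqVneq i j.
by rewrite mulr0 => /eqP; rewrite eq_sym oner_eq0.
Qed.

Lemma nilradical_coord x i : nilradical alpha x -> coord e i x != 0 ->
  exists2 r, Delta_pos alpha r & lam i = wt r.
Proof.
move=> [s [sP ->]]; rewrite linear_sum /= => xi.
have [y ys yi] : exists2 y, y \in s & coord e i y != 0.
  apply: contrapT => ny; case/eqP: xi; rewrite big_seq big1 // => y ys.
  by apply: contrapT => yi; apply: ny; exists y => //; apply/eqP.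
have [r pr ry] := sP y ys; exists r => //.
exact: ((coord_weight e_basis e_weight _ _).1 ry).
Qed.

Lemma borel_cartan (h : subvs_of t) : borel alpha (vsval h).
Proof.
exists 0, (vsval h); split; [exists [::]; split=> //;
  by rewrite big_nil| |by rewrite add0r].
exact: subvsP.
Qed.

(** Components are removed one at a time: applying [h - lam_j(h)] kills the [j]-th coordinate and
    keeps the [i]-th when the two weights differ on [h]. Such an [h] exists because root spaces are
    lines. *)
Lemma stable_coord_mem a x i : (forall (h : subvs_of t) y, y \in a ->
  [lie vsval h, y] \in a) ->
  is_root (lam i) -> x \in a -> coord e i x != 0 -> tnth e i \in a.
Proof.
move=> a_stable ri; have [m] := ubnP #|[pred j | coord e j x != 0]|.
elim: m => // m IH in x *; rewrite ltnS => xm xa xi.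
have [[j [ji xj]]|/forallNP only_i] := pselect (exists j, j != i /\ coord e j x != 0).
  have /lfunPn[h lh] : lam i != lam j.
    by apply: contraNneq ji => ij; rewrite (lam_root_inj ri ij).
  pose y := [lie vsval h, x] - lam j h *: x.
  have yE k : coord e k y = (lam k h - lam j h) * coord e k x.
    by rewrite linearB linearZ /= (coord_cartan e_basis e_weight) mulrBl.
  apply: (IH y).
  - apply: leq_trans xm; apply: proper_card; apply/properP; split.
      by apply/fintype.subsetP => k; rewrite !inE yE mulf_eq0 negb_or => /andP[].
    by exists j; rewrite !inE ?xj // yE subrr mul0r eqxx.
  - by rewrite memvB ?memvZ // a_stable.
  - by rewrite yE mulf_neq0 // subr_eq0.
have xE : x = coord e i x *: tnth e i.
  rewrite {1}(coordE e_basis x) (bigD1 i) //= big1 ?addr0 // => j ji.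
  have [->|xj] := eqVneq (coord e j x) 0; first by rewrite scale0r.
  by case: (only_i j).
by rewrite -[tnth e i](scalerK xi) -xE memvZ.
Qed.

Section Ideal.
Variable a : {vspace g}.
Hypothesis a_ab : abelian_ideal alpha a.

Lemma abelian_ideal_coord x i : x \in a -> coord e i x != 0 ->
  tnth e i \in a /\ exists2 r, ideal_roots alpha a r & lam i = wt r.
Proof.
have [a_nil a_ideal _] := a_ab.
move=> xa xi; have [r pr ir] := nilradical_coord (a_nil x xa) xi.
have ri : is_root (lam i) by rewrite ir; case: pr.
have ia : tnth e i \in a.
  by apply: (stable_coord_mem _ ri xa xi) => h y; apply/a_ideal/borel_cartan.
split=> //; exists r => //; split=> // y ry.
have yi : weight_space (lam i) y by rewrite ir.
have [c ->] := root_space_line e_basis e_weight t_cartan (kn ri) ri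
  (e_weight i) (tnth_neq0 e_basis i) yi.
exact: memvZ.
Qed.

End Ideal.

Lemma ideal_roots_sub a b : abelian_ideal alpha a ->
  (forall r, ideal_roots alpha a r -> ideal_roots alpha b r) -> (a <= b)%VS.
Proof.
move=> a_ab ab; apply/subvP => x xa; rewrite (coordE e_basis x).
apply: memv_suml => i _; have [->|xi] := eqVneq (coord e i x) 0.
  by rewrite scale0r mem0v.
have [_ [r /ab[_ rb] ir]] := abelian_ideal_coord a_ab xa xi.
by apply/memvZ/rb; rewrite /root_space -ir.
Qed.

Lemma ideal_roots_cap a b r :
  ideal_roots alpha (a :&: b)%VS r <-> ideal_roots alpha a r /\ ideal_roots alpha b r.
Proof.
split=> [[pr rab]|[[pr ra] [_ rb]]].
  by split; split=> // x /rab; rewrite memv_cap => /andP[].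
by split=> // x rx; rewrite memv_cap ra ?rb.
Qed.

Lemma abelian_ideal_cap a b : abelian_ideal alpha a -> abelian_ideal alpha b ->
  abelian_ideal alpha (a :&: b)%VS.
Proof.
move=> [a1 a2 a3] [b1 b2 b3]; split.
- by move=> x; rewrite memv_cap => /andP[/a1].
- by move=> x y bx; rewrite !memv_cap => /andP[ya yb]; rewrite a2 ?b2.
- by move=> x y; rewrite !memv_cap => /andP[xa _] /andP[ya _]; apply: a3.
Qed.

Lemma ideal_roots_neq0 a r : ideal_roots alpha a r -> a != 0%VS.
Proof.
move=> [[[_ [x rx x0]] _] ra]; apply: contraNneq x0 => a0.
by rewrite -memv0 -a0; apply: ra.
Qed.

(** Root spaces are mere sets here, so the subspace is spanned by the weight vectors of [e] whose
    weight lies in [I]; these have a finite index type. *)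
Definition root_ideal I : {vspace g} :=
  (\sum_(i | `[< exists2 r, I r & lam i = wt r >]) <[tnth e i]>)%VS.

Lemma root_idealP I x : reflect
  (forall i, coord e i x != 0 -> exists2 r, I r & lam i = wt r) (x \in root_ideal I).
Proof.
apply: (iffP idP) => [/memv_sumP[v vP ->] i|xP].
  rewrite linear_sum /= => vi; have [j Pj vj] : exists2 j,
      exists2 r, I r & lam j = wt r & coord e i (v j) != 0.
    apply: contrapT => nj; case/eqP: vi; rewrite big1 // => j /asboolP Pj.
    by apply: contrapT => vj; apply: nj; exists j => //; apply/eqP.
  have /vlineP[c cE] := vP j (introT (asboolP _) Pj).
  move: vj; rewrite cE linearZ /= coord_tnth //; have [<- //|_] := eqVneq j i.
  by rewrite mulr0 eqxx.
rewrite (coordE e_basis x) memv_suml // => i _.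
have [->|/xP Pi] := eqVneq (coord e i x) 0; first by rewrite scale0r mem0v.
apply: memvZ; have /asboolP Pi' := Pi.
by apply: (subvP (sumv_sup i Pi' (subvv _))); apply: memv_line.
Qed.

Lemma root_ideal_weight I r x : I r -> root_space alpha r x -> x \in root_ideal I.
Proof.
move=> Ir rx; apply/root_idealP => i xi; exists r => //.
exact: ((coord_weight e_basis e_weight _ _).1 rx).
Qed.

Lemma ideal_roots_root_ideal I r : (forall r, I r -> Delta_pos alpha r) ->
  ideal_roots alpha (root_ideal I) r <-> I r.
Proof.
move=> Ipos; split=> [[pr rI]|Ir]; last first.
  by split; [exact: Ipos|move=> x; apply: root_ideal_weight].
have [_ [i ir]] := (is_root_lam e_basis e_weight _).1 pr.1.
have /rI/root_idealP/(_ i) : root_space alpha r (tnth e i).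
  by rewrite /root_space -ir; apply: e_weight.
rewrite coord_tnth // eqxx oner_eq0 => /(_ isT)[r' Ir' ir'].
by suff -> : r = r' by []; apply: (weight_of_inj alpha_base); rewrite -ir -ir'.
Qed.

Lemma bracket_root_space r r' x y : Delta_pos alpha r -> Delta_pos alpha r' ->
  root_space alpha r x -> root_space alpha r' y ->
  root_space alpha (r + r') [lie x, y] /\ (~ D (r + r') -> [lie x, y] = 0).
Proof.
move=> [Dr r0] [Dr' r'0] rx ry.
have rxy : root_space alpha (r + r') [lie x, y].
  by rewrite /root_space weight_ofD; apply: weight_bracket.
split=> // nD; apply/eqP/negP => /negP xy0; apply: nD; split; last by exists [lie x, y].
rewrite -(weight_of0 alpha); apply/eqP => /(weight_of_inj alpha_base) E.
have nr : r = - r' by apply/eqP; rewrite -addr_eq0 E.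
apply: (rs_neq0 rs); suff <- : r' = 0 by [].
by apply: root_leN => //; rewrite -nr.
Qed.

Lemma root_ideal_abelian I : (forall r, I r -> Delta_pos alpha r) ->
  sum_closed alpha I -> sum_free alpha I -> abelian_ideal alpha (root_ideal I).
Proof.
move=> Ipos Ic If; split.
- move=> x /root_idealP xI.
  exists [seq coord e i x *: tnth e i | i <- enum 'I_(dim g) & coord e i x != 0]; split.
    move=> y /mapP; case=> i; rewrite mem_filter => /andP[xi _] ->.
    have [r Ir ir] := xI i xi; exists r; first exact: Ipos.
    by rewrite /root_space -ir; apply: weight_scale.
  rewrite big_map big_filter {1}(coordE e_basis x) big_enum_cond /=.
  rewrite [LHS](bigID (fun i => coord e i x != 0)) /= [X in _ + X]big1 ?addr0 //.
  by move=> i /negPn/eqP ->; rewrite scale0r.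
- move=> _ z [y [h [[s [sP ->]] ht ->]]] zI; rewrite lieDl memvD //; last first.
    apply/root_idealP => i; rewrite -(vsprojK ht) (coord_cartan e_basis e_weight).
    by rewrite mulf_eq0 negb_or => /andP[_]; apply/root_idealP.
  rewrite lie_suml big_seq; apply: memv_suml => y0 y0s.
  have [r pr ry] := sP y0 y0s; rewrite (coordE e_basis z) linear_sum /=.
  apply: memv_suml => i _; rewrite lieZr.
  have [->|zi] := eqVneq (coord e i z) 0; first by rewrite scale0r mem0v.
  apply: memvZ; have [r' Ir' ir'] := root_idealP _ _ zI i zi.
  have [|bw b0] := bracket_root_space pr (Ipos _ Ir') ry (y := tnth e i).
    by rewrite /root_space -ir'; apply: e_weight.
  have [Drr|/b0 ->] := pselect (D (r + r')); last exact: mem0v.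
  apply: root_ideal_weight bw; rewrite addrC; apply: Ic => //.
  by rewrite addrC.
- move=> x y xI yI; rewrite (coordE e_basis x) lie_suml big1 // => i _.
  rewrite lieZl; have [->|xi] := eqVneq (coord e i x) 0; first by rewrite scale0r.
  rewrite (coordE e_basis y) linear_sum /= big1 ?scaler0 // => j _; rewrite lieZr.
  have [->|yj] := eqVneq (coord e j y) 0; first by rewrite scale0r.
  have [r Ir ir] := root_idealP _ _ xI i xi.
  have [r' Ir' ir'] := root_idealP _ _ yI j yj.
  have [||_ b0] := @bracket_root_space r r' (tnth e i) (tnth e j) (Ipos _ Ir) (Ipos _ Ir').
  + by rewrite /root_space -ir; apply: e_weight.
  + by rewrite /root_space -ir'; apply: e_weight.
  by rewrite b0 ?scaler0 //; apply: If.
Qed.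

Lemma aff_weyl_act w : aff_weyl_group G theta w <-> exists s, w = wact G theta s.
Proof.
split=> [|[s ->]].
  elim=> [|_ {}w [aa aE ->] _ [s ->]]; first by exists [::].
  by case: aE => [->|[i ->]]; [exists (None :: s)|exists (Some i :: s)].
elim: s => [|j s IH]; first exact: generated_id.
apply: (generated_comp (s := srefl G theta j)) IH.
exists (asimple theta j) => //; case: j => [i|]; [by right; exists i|by left].
Qed.

Lemma rootlet_set a mu :
  rootlet alpha G theta a mu <-> set_rootlet alpha G theta (ideal_roots alpha a) mu.
Proof.
have invP s : inversions alpha (wact G theta s) =
    [set x | exists2 r, ideal_roots alpha a r & x = delta R n - affV_of r]%classic <->
    minuscule alpha G theta (ideal_roots alpha a) s.
  split=> [E x|E].
    have : inversions alpha (wact G theta s) x <-> inversion alpha G theta s x by [].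
    by rewrite E => <-.
  by apply/predeqP => x; apply: E.
split=> [[_ [/aff_weyl_act[s ->] /invP sa] smu]|[s sa smu]]; first by exists s.
by exists (wact G theta s) => //; split; [apply/aff_weyl_act; exists s|apply/invP].
Qed.

Lemma Ab_set a mu : Ab alpha G theta mu a <->
  abelian_ideal alpha a /\ set_rootlet alpha G theta (ideal_roots alpha a) mu.
Proof.
split=> [[a1 a2 /rootlet_set//]|[a1 sa]].
split=> //; last exact/rootlet_set.
by have [s sI smu] := sa; apply: ideal_roots_neq0 (wrootlet_theta rs sI smu).
Qed.

Lemma Ab_root_ideal I mu : set_rootlet alpha G theta I mu ->
  Ab alpha G theta mu (root_ideal I).
Proof.
move=> sI; have [s s_min smu] := sI.
have Ipos r : I r -> Delta_pos alpha r by apply: (minuscule_pos rs s_min).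
apply/Ab_set; split.
  apply: root_ideal_abelian => //; first exact: (minuscule_sum_closed rs s_min).
  exact: (minuscule_sum_free rs s_min).
suff -> : ideal_roots alpha (root_ideal I) = I by [].
by apply/predeqP => r; apply: ideal_roots_root_ideal.
Qed.

End AbelianIdeals.

(** * Least and greatest ideals with a given rootlet *)

Lemma exists_minimal_vspace (F : fieldType) (U : vectType F) (P : {vspace U} ->
  Prop) b :
  P b -> exists a, [/\ P a, (a <= b)%VS & forall c, P c -> (c <= a)%VS -> c = a].
Proof.
have [m] := ubnP (\dim b); elim: m => // m IH in b *; rewrite ltnS => bm Pb.
have [b_min|] := pselect (forall c, P c -> (c <= b)%VS -> c = b); first by exists b.
move=> /existsNP[c /not_implyP[Pc /not_implyP[cb ncb]]].
have cm : (\dim c < m)%N.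
  apply: leq_trans bm; rewrite ltn_neqAle dimvS // andbT.
  by apply: contra_not_neq ncb => E; apply/eqP; rewrite eqEdim cb E leqnn.
have [a [Pa ac a_min]] := IH c cm Pc.
by exists a; split=> //; apply: subv_trans cb.
Qed.

Lemma exists_maximal_vspace (F : fieldType) (U : vectType F) (P : {vspace U} ->
  Prop) b :
  P b -> exists a, [/\ P a, (b <= a)%VS & forall c, P c -> (a <= c)%VS -> c = a].
Proof.
have [m] := ubnP (\dim {:U} - \dim b); elim: m => // m IH in b *; rewrite ltnS => bm Pb.
have [b_max|] := pselect (forall c, P c -> (b <= c)%VS -> c = b); first by exists b.
move=> /existsNP[c /not_implyP[Pc /not_implyP[bc ncb]]].
have cm : (\dim {:U} - \dim c < m)%N.
  have bc' : (\dim b < \dim c)%N.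
    rewrite ltn_neqAle dimvS // andbT.
    by apply: contra_not_neq ncb => E; apply/esym/eqP; rewrite eqEdim bc E leqnn.
  by have := dimvS (subvf c); lia.
have [a [Pa ca a_max]] := IH c cm Pc.
by exists a; split=> //; apply: subv_trans ca.
Qed.

Section ExtremalIdeals.
Variables (R : realType) (g : lieAlgType R[i]) (t : {vspace g}) (n : nat).
Variables (alpha : n.-tuple (dual R[i] t)) (G : 'M[R]_n) (theta mu : 'rV[R]_n).

(** By finite dimension every member of the family contains a minimal one, which by uniqueness is
    [a]. *)
Lemma is_Imin_least a : is_Imin alpha G theta mu a ->
  forall b, Ab alpha G theta mu b -> (a <= b)%VS.
Proof.
move=> [_ a_uniq] b /exists_minimal_vspace[c [cmu cb c_min]].
by rewrite (a_uniq c).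
Qed.

Lemma least_is_Imin a : Ab alpha G theta mu a ->
  (forall b, Ab alpha G theta mu b -> (a <= b)%VS) -> is_Imin alpha G theta mu a.
Proof.
move=> amu a_le; split=> [|b [bmu b_min]]; last by apply: b_min => //; apply: a_le.
by split=> // b /a_le ab ba; apply/eqP; rewrite eqEsubv ba.
Qed.

Lemma is_Imax_greatest a : is_Imax alpha G theta mu a ->
  forall b, Ab alpha G theta mu b -> (b <= a)%VS.
Proof.
move=> [_ a_uniq] b /exists_maximal_vspace[c [cmu bc c_max]].
by rewrite (a_uniq c).
Qed.

Lemma greatest_is_Imax a : Ab alpha G theta mu a ->
  (forall b, Ab alpha G theta mu b -> (b <= a)%VS) -> is_Imax alpha G theta mu a.
Proof.
move=> amu a_ge; split=> [|b [bmu b_max]]; last by apply: b_max => //; apply: a_ge.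
by split=> // b /a_ge ba ab; apply/eqP; rewrite eqEsubv ba.
Qed.

End ExtremalIdeals.

Theorem theorem0p1 (R : realType) (g : lieAlgType R[i]) (t : {vspace g}) (n : nat)
    (alpha : n.-tuple (dual R[i] t)) (G : 'M[R]_n) (theta : 'rV[R]_n)
    (g_simple : lie_simple g) (t_cartan : cartan_subalgebra t)
    (alpha_base : root_base alpha) (G_inner : invariant_inner_product alpha G)
    (theta_highest : highest_root alpha theta)
    (mu mu' : 'rV[R]_n)
    (mu_long : Delta_long_pos alpha G mu) (mu'_long : Delta_long_pos alpha G mu') :
  exists nu : 'rV[R]_n,
    unique (is_long_join alpha G mu mu') nu /\
    (forall I I' : {vspace g},
       Ab alpha G theta mu I -> Ab alpha G theta mu' I' ->
       Ab alpha G theta nu (I :&: I')%VS) /\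
    (forall I I' : {vspace g},
       is_Imin alpha G theta mu I -> is_Imin alpha G theta mu' I' ->
       is_Imin alpha G theta nu (I :&: I')%VS) /\
    (forall I I' : {vspace g},
       is_Imax alpha G theta mu I -> is_Imax alpha G theta mu' I' ->
       is_Imax alpha G theta nu (I :&: I')%VS) /\
    (forall J : {vspace g}, Ab alpha G theta nu J ->
       exists I I' : {vspace g},
         [/\ Ab alpha G theta mu I, Ab alpha G theta mu' I' & J = (I :&: I')%VS]).
Proof.
have [e [lam [e_basis e_weight]]] := weight_basis t_cartan.
have rs := root_system g_simple t_cartan alpha_base G_inner theta_highest e_basis e_weight.
have longE x : Delta_long_pos alpha G x <-> long_pos (Delta alpha) G x.
  by split=> [[[Dx x0] xl]|[[Dx xl] x0]].
have lmu := (longE mu).1 mu_long; have lmu' := (longE mu').1 mu'_long.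
have AbE := Ab_set g_simple t_cartan alpha_base G_inner theta_highest e_basis e_weight.
(* Sample sets with rootlets [mu] and [mu'], obtained by descending from the set [{theta}]; they
   serve only to produce [nu]. *)
have [I0 mI0] := set_rootlet_nonempty rs lmu.
have [I0' mI0'] := set_rootlet_nonempty rs lmu'.
have [nu [_ lnu munu mu'nu nu_min]] := set_rootlet_meet rs mI0 mI0' lmu lmu'.
have capP I I' : Ab alpha G theta mu I -> Ab alpha G theta mu' I' ->
    Ab alpha G theta nu (I :&: I')%VS.
  move=> /AbE[I_ab mI] /AbE[I'_ab mI']; apply/AbE; split;
    first exact: abelian_ideal_cap.
  have [nu' [mJ lnu' munu' mu'nu' nu'_min]] := set_rootlet_meet rs mI mI' lmu lmu'.
  (* Both are least among the long roots above [mu] and [mu'], so the rootlet of this intersection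
     agrees with that of the sample. *)
  have -> : nu = nu' by apply: root_le_anti; [apply: nu_min|apply: nu'_min].
  suff -> : ideal_roots alpha (I :&: I')%VS =
      (fun r => ideal_roots alpha I r /\ ideal_roots alpha I' r) by [].
  by apply/predeqP => r; apply: ideal_roots_cap.
have splitP J : Ab alpha G theta nu J -> exists I I' : {vspace g},
    [/\ Ab alpha G theta mu I, Ab alpha G theta mu' I' & J = (I :&: I')%VS].
  move=> /AbE[J_ab mJ].
  have [I [I' [mI mI' JE]]] := set_rootlet_split rs mJ lnu lmu lmu' munu mu'nu nu_min.
  have ideal_of := Ab_root_ideal g_simple t_cartan alpha_base G_inner theta_highest e_basis e_weight.
  have sub_of := ideal_roots_sub g_simple t_cartan alpha_base e_basis e_weight.
  have roots_of K kap : set_rootlet alpha G theta K kap -> forall r,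
      ideal_roots alpha (root_ideal alpha e lam K) r <-> K r.
    move=> [s sK _] r; apply: (ideal_roots_root_ideal alpha_base e_basis e_weight).
    by move=> r'; apply: (minuscule_pos rs sK).
  exists (root_ideal alpha e lam I), (root_ideal alpha e lam I').
  have aI := ideal_of _ _ mI; have aI' := ideal_of _ _ mI'.
  have [ab _] := (AbE _ _).1 aI; have [ab' _] := (AbE _ _).1 aI'.
  split=> //; apply/eqP; rewrite eqEsubv; apply/andP; split; apply: sub_of => //.
  - move=> r /JE[Ir I'r]; apply/ideal_roots_cap.
    by split; [apply/(roots_of _ _ mI)|apply/(roots_of _ _ mI')].
  - exact: abelian_ideal_cap.
  - by move=> r /ideal_roots_cap[/(roots_of _ _ mI) Ir /(roots_of _ _ mI') I'r];
    apply/JE.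
exists nu; split; [|split; [|split; [|split]]] => //.
- have joinE : is_long_join alpha G mu mu' nu.
    by split=> //; [exact/longE|move=> x /longE; apply: nu_min].
  split=> // nu' [lnu' munu' mu'nu' nu'_min].
  by apply: root_le_anti; [apply: nu_min => //; apply/longE|apply: nu'_min => //;
    apply/longE].
- move=> I I' I_min I'_min; apply: least_is_Imin.
    by apply: capP; [case: I_min => -[]|case: I'_min => -[]].
  (* Every ideal with rootlet [nu] is an intersection of ideals with rootlets [mu] and [mu'], and
     each of these contains the corresponding least one. *)
  move=> J /splitP[a [a' [amu a'mu' ->]]].
  by apply: capvS; [apply: is_Imin_least I_min _ amu|apply: is_Imin_least I'_min _ a'mu'].
- move=> I I' I_max I'_max; apply: greatest_is_Imax.
    by apply: capP; [case: I_max => -[]|case: I'_max => -[]].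
  move=> J /splitP[a [a' [amu a'mu' ->]]].
  by apply: capvS; [apply: is_Imax_greatest I_max _ amu|apply: is_Imax_greatest I'_max _ a'mu'].
Qed.
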